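(* Let $m=n$ and let ${\bf f}$ be generic, so that $V_{\bf f}$ is finite. Let $x\neq x'$ be two points of $V_{\bf f}$, let $S_x=x-\tfrac12\mathrm{Jac}_{\bf f}(x)\cdot\mathrm{S}^{ed}_{\bf f}$ and $S_{x'}=x'-\tfrac12\mathrm{Jac}_{\bf f}(x')\cdot\mathrm{S}^{ed}_{\bf f}$, and let $\mathrm{bsc}\subset\mathbb{R}^n$ be the bisector hyperplane of $x$ and $x'$ (the set of points equidistant from $x$ and $x'$). Then there is a point $u\in\mathbb{R}^n$ at which the three hypersurfaces $\mathrm{bsc}$, $\partial_{\rm alg}S_x$ and $\partial_{\rm alg}S_{x'}$ meet tangentially.
   Context: ${\bf f}=(f_1,\dots,f_n)$ with $f_i(x)=x^TA_ix+2a_i^Tx+\alpha_i$ ($A_i$ real symmetric $n\times n$, $a_i\in\mathbb{R}^n$, $\alpha_i\in\mathbb{R}$), $V_{\bf f}=\{x\in\mathbb{R}^n:f_i(x)=0\ \forall i\}$, $\mathrm{Jac}_{\bf f}(x)$ the $n\times n$ Jacobian with $(i,j)$ entry $\partial f_j/\partial x_i$, and $\mathrm{S}^{ed}_{\bf f}=\{\lambda\in\mathbb{R}^n:\sum_i\lambda_iA_i\prec I_n\}$. $\partial_{\rm alg}S$ denotes the algebraic boundary (Zariski closure of the topological boundary) of $S$. *)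

(* Defs.v *)
From HB Require Import structures.
From mathcomp Require Import all_boot all_order all_algebra.
From mathcomp Require Import reals.
From mathcomp Require Import mpoly.
Set Implicit Arguments. Unset Strict Implicit. Unset Printing Implicit Defensive.
Import Order.TTheory GRing.Theory Num.Theory.
Local Open Scope ring_scope.

Section Defs.
Variables (R : realType) (n : nat).

Definition coordsv (x : 'cV[R]_n) : 'I_n -> R := fun i => x i ord0.

Definition fpoly (A : 'I_n -> 'M[R]_n) (a : 'I_n -> 'cV[R]_n) (al : 'I_n -> R)
  (i : 'I_n) : {mpoly R[n]} :=
  \sum_(k < n) \sum_(l < n) (A i k l)%:MP * 'X_k * 'X_l
  + \sum_(k < n) (2 * a i k ord0)%:MP * 'X_k + (al i)%:MP.

Definition Vf A a al (x : 'cV[R]_n) : Prop :=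
  forall i, (fpoly A a al i).@[coordsv x] = 0.

Definition Jacf A a al (x : 'cV[R]_n) : 'M[R]_n :=
  \matrix_(i < n, j < n) (mderiv i (fpoly A a al j)).@[coordsv x].

Definition posdef (M : 'M[R]_n) : Prop :=
  forall v : 'cV[R]_n, v != 0 -> 0 < (v^T *m M *m v) ord0 ord0.

Definition Sed (A : 'I_n -> 'M[R]_n) (lam : 'cV[R]_n) : Prop :=
  posdef (1%:M - \sum_(i < n) lam i ord0 *: A i).

Definition Sx A a al (x : 'cV[R]_n) (u : 'cV[R]_n) : Prop :=
  exists2 lam, Sed A lam & u = x - 2^-1 *: (Jacf A a al x *m lam).

Definition sqnorm (v : 'cV[R]_n) : R := \sum_(i < n) v i ord0 ^+ 2.

Definition topbd (S : 'cV[R]_n -> Prop) (u : 'cV[R]_n) : Prop :=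
  forall e : R, 0 < e ->
    (exists v, S v /\ sqnorm (v - u) < e ^+ 2) /\
    (exists w, ~ S w /\ sqnorm (w - u) < e ^+ 2).

Definition vanishes_on (p : {mpoly R[n]}) (S : 'cV[R]_n -> Prop) : Prop :=
  forall v, S v -> p.@[coordsv v] = 0.

Definition zcl (S : 'cV[R]_n -> Prop) (u : 'cV[R]_n) : Prop :=
  forall p : {mpoly R[n]}, vanishes_on p S -> p.@[coordsv u] = 0.

Definition algbd (S : 'cV[R]_n -> Prop) : 'cV[R]_n -> Prop := zcl (topbd S).

Definition tangent_space (Z : 'cV[R]_n -> Prop) (u : 'cV[R]_n) (w : 'cV[R]_n) : Prop :=
  forall p : {mpoly R[n]}, vanishes_on p Z ->
    \sum_(i < n) (mderiv i p).@[coordsv u] * w i ord0 = 0.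

Definition bisector (x x' : 'cV[R]_n) (u : 'cV[R]_n) : Prop :=
  sqnorm (u - x) = sqnorm (u - x').

Definition meet_tangentially (Z1 Z2 Z3 : 'cV[R]_n -> Prop) (u : 'cV[R]_n) : Prop :=
  [/\ Z1 u, Z2 u, Z3 u,
      (forall w, tangent_space Z1 u w <-> tangent_space Z2 u w) &
      (forall w, tangent_space Z1 u w <-> tangent_space Z3 u w)].

End Defs.

Definition coefT (n : nat) : finType :=
  (('I_n * 'I_n * 'I_n) + ('I_n * 'I_n) + 'I_n)%type.

Definition coef_of (R : realType) (n : nat) (A : 'I_n -> 'M[R]_n)
  (a : 'I_n -> 'cV[R]_n) (al : 'I_n -> R) (c : coefT n) : R :=
  match c with
  | inl (inl (i, k, l)) => A i k l
  | inl (inr (i, k)) => a i k ord0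
  | inr i => al i
  end.

Definition coords (R : realType) (n : nat) (A : 'I_n -> 'M[R]_n)
  (a : 'I_n -> 'cV[R]_n) (al : 'I_n -> R) : 'I_#|{: coefT n}| -> R :=
  fun k => coef_of A a al (enum_val k).

(* Main.v *)
Require Import Defs.
From mathcomp Require Import all_boot all_order all_algebra.
From mathcomp Require Import boolp classical_sets reals.
From mathcomp Require Import polyrcf mpoly.
From mathcomp Require Import ring lra.
Set Implicit Arguments. Unset Strict Implicit. Unset Printing Implicit Defensive.
Import Order.TTheory GRing.Theory Num.Theory.
Local Open Scope ring_scope.

(* Put d = x' - x, let B(d) be the matrix with columns A_j d, J(x) the one with
   columns A_j x + a_j (half the Jacobian), and M(l) = I - sum_j l_j A_j.
   Solve B(d) l = d, that is M(l) d = 0, and take u = x - J(x) l.  Since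
   f_j(x) = f_j(x') = 0 one has d^T (A_j x + a_j) = - (d^T A_j d) / 2, whence
   u = x' - J(x') l, u lies on the bisector, and the normal of the hypersurface
   det M = 0 at l, which is (d^T A_j d)_j, is carried to d by both x - J(x) l
   and x' - J(x') l.

   That l lies on the algebraic boundary of the spectrahedron, with the expected
   tangent space, follows from the rational parametrization d |-> B(d)^-1 d of
   det M = 0: a polynomial vanishing on the boundary vanishes on the image of a
   small open set of d's, namely around an eigenvector of A_o spanning the kernel
   of a boundary point of the form t e_o, hence on the image of all d's, and it
   can be differentiated along the parametrization.

   This needs J(x), B(d) invertible and M(l) of corank 1 for all pairs of zeros
   at once.  The incidence variety of data and pairs is parametrized by as many
   parameters as there are data, and N + 1 polynomials in N variables are
   algebraically dependent: so for a nonzero polynomial h in the parameters there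
   is a nonzero polynomial P in the data whose pullback is a multiple of h.  The
   same regularity at the eigenvectors of A_o is of the form q(theta) != 0 for a
   polynomial q depending on the data, and det q(A_o) != 0 ensures it at all the
   eigenvalues theta of A_o. *)

(** * Algebraic dependence and genericity *)

Section SizeOfProducts.
Variables (R : idomainType) (n : nat).
Implicit Types p q : {mpoly R[n]}.

Lemma msizeM_leqS p q d e :
  (msize p <= d.+1)%N -> (msize q <= e.+1)%N -> (msize (p * q) <= (d + e).+1)%N.
Proof.
move=> pd qe; have [->|p0] := eqVneq p 0; first by rewrite mul0r msize0.
have [->|q0] := eqVneq q 0; first by rewrite mulr0 msize0.
by rewrite msizeM // -subn1 leq_subLR add1n -addnS -addSn leq_add.
Qed.

Lemma msize_prod_leqS (I : Type) (r : seq I) (F : I -> {mpoly R[n]}) (d : I -> nat) :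
  (forall i, msize (F i) <= (d i).+1)%N ->
  (msize (\prod_(i <- r) F i) <= (\sum_(i <- r) d i).+1)%N.
Proof.
by move=> Fd; elim/big_rec2: _ => [|i e p _]; [rewrite msize1|apply: msizeM_leqS].
Qed.

Lemma msizeX_leqS p d k : (msize p <= d.+1)%N -> (msize (p ^+ k) <= (k * d).+1)%N.
Proof.
move=> pd; have := msize_prod_leqS (index_enum 'I_k) (fun=> pd).
by rewrite prodr_const sum_nat_const card_ord.
Qed.

End SizeOfProducts.

Section BoundedExponents.
Variables n k : nat.

Definition mnm_of_ffun (m : {ffun 'I_n -> 'I_k}) : 'X_{1..n} :=
  [multinom (m i : nat) | i < n].

Lemma mnm_of_ffun_inj : injective mnm_of_ffun.
Proof.
move=> m m' /mnmP eq_m; apply/ffunP=> i; apply: val_inj.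
by have := eq_m i; rewrite !mnmE.
Qed.

Lemma mnm_of_ffun_onto (m : 'X_{1..n}) : (mdeg m < k)%N -> exists u, m = mnm_of_ffun u.
Proof.
move=> mk; have lt_m i : (m i < k)%N.
  by apply: leq_ltn_trans mk; rewrite mdegE (bigD1 i) //= leq_addr.
by exists [ffun i => Ordinal (lt_m i)]; apply/mnmP=> i; rewrite mnmE ffunE.
Qed.

End BoundedExponents.

Section AlgebraicDependence.
Variables (R : fieldType) (N : nat).

Lemma mpoly_linear_dependence (T : finType) (G : T -> {mpoly R[N]}) k :
  (forall t, msize (G t) <= k)%N -> (k ^ N < #|T|)%N ->
  exists2 c : T -> R, (exists t, c t != 0) & \sum_t c t *: G t = 0.
Proof.
move=> Gk lt_kT.
pose C := \matrix_(i < #|T|, j < #|{ffun 'I_N -> 'I_k}|)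
  (G (enum_val i))@_(mnm_of_ffun (enum_val j)).
have : kermx C != 0.
  rewrite kermx_eq0 /row_free neq_ltn (leq_ltn_trans (rank_leq_col _)) //.
  by rewrite card_ffun !card_ord.
case/rowV0Pn => c /sub_kermxP cC /rV0Pn[i ci].
exists (fun t => c 0 (enum_rank t)); first by exists (enum_val i); rewrite enum_valK.
apply/mpolyP=> m; rewrite mcoeff0 raddf_sum /=; under eq_bigr do rewrite mcoeffZ.
have [/mnm_of_ffun_onto[u ->]|km] := ltnP (mdeg m) k; last first.
  apply: big1 => t _; rewrite memN_msupp_eq0 ?mulr0 //.
  exact/msize_mdeg_ge/(leq_trans (Gk t)).
have /rowP/(_ (enum_rank u)) := cC; rewrite !mxE => E.
rewrite -[RHS]E (reindex (@enum_val T predT)) /=; last first.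
  by exists enum_rank => t _; rewrite ?enum_valK ?enum_rankK.
by apply: eq_bigr => j _; rewrite mxE enum_valK enum_rankK.
Qed.

(* The [k ^ n] monomials in the [F i] with exponents below [k] have degree
   [O(k)], hence lie in a space of dimension [O(k ^ N)]. *)
Lemma mpoly_algebraic_dependence n (F : 'I_n -> {mpoly R[N]}) : (N < n)%N ->
  exists2 Q : {mpoly R[n]}, Q != 0 & mmap (@mpolyC N R) F Q = 0.
Proof.
move=> lt_Nn; pose e := (\max_i msize (F i))%N; pose b := (n * e).+1.
pose k := (b ^ N).+1; pose T := {ffun 'I_n -> 'I_k}.
pose G (m : T) := \prod_i F i ^+ m i.
have Fe i : (msize (F i) <= e.+1)%N by rewrite leqW // (leq_bigmax i).
have Gk m : (msize (G m) <= k * b)%N.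
  have := msize_prod_leqS (index_enum 'I_n) (fun i => msizeX_leqS (m i) (Fe i)).
  move/leq_trans; apply; rewrite mulnS -add1n leq_add // mulnCA.
  rewrite -[X in (_ <= X * _)%N]card_ord -sum_nat_const.
  by apply: leq_sum => i _; rewrite leq_mul2r ltnW ?orbT.
have ltT : ((k * b) ^ N < #|{: T}|)%N.
  rewrite card_ffun !card_ord expnMn; apply: leq_trans (_ : k ^ N.+1 <= _)%N.
    by rewrite expnSr ltn_pmul2l ?expn_gt0.
  by rewrite leq_pexp2l.
have [c [m0 cm0] sumG0] := mpoly_linear_dependence Gk ltT.
exists (\sum_m c m *: 'X_[mnm_of_ffun m]).
  apply: contraNneq cm0 => /(congr1 (mcoeff (mnm_of_ffun m0)))/eqP.
  rewrite mcoeff0 raddf_sum (bigD1 m0) //= mcoeffZ mcoeffX eqxx mulr1 big1 ?addr0 //.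
  move=> m /negPf neq; rewrite mcoeffZ mcoeffX (inj_eq (@mnm_of_ffun_inj _ _)) neq mulr0 //.
rewrite raddf_sum -[RHS]sumG0; apply: eq_bigr => m _ /=.
rewrite mmapZ mmapX mul_mpolyC; congr (_ *: _); apply: eq_bigr => i _.
by rewrite mnmE.
Qed.

End AlgebraicDependence.

Section EvaluationOfMuni.
Variables (R S : comNzRingType) (f : {rmorphism R -> S}) (n : nat).
Implicit Types p : {mpoly R[n.+1]}.

Definition extend_ord (u : 'I_n -> S) (t : S) (i : 'I_n.+1) : S :=
  oapp u t (unlift ord_max i).

Lemma horner_mmap_muni u t p :
  (map_poly (mmap f u) (muni p)).[t] = mmap f (extend_ord u t) p.
Proof.
rewrite muniE raddf_sum horner_sum; apply: eq_bigr => m _ /=.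
rewrite map_polyZ map_polyXn hornerZ hornerXn /= mmapZ mmapX -mulrA; congr (_ * _).
rewrite /mmap1 big_ord_recr /extend_ord /= unlift_none; congr (_ * _).
apply: eq_bigr => i _; rewrite mnmE; set j := widen_ord _ i.
by have -> : j = lift ord_max i; [exact/val_inj/esym/lift_max|rewrite liftK].
Qed.

End EvaluationOfMuni.

Lemma eq_mmap (R S : comNzRingType) (f : {rmorphism R -> S}) n (u v : 'I_n -> S) p :
  u =1 v -> mmap f u p = mmap f v p.
Proof. by move=> uv; apply: eq_bigr => m _; rewrite (mmap1_eq _ uv). Qed.

Lemma mmap_mpolyX (R : comNzRingType) n (p : {mpoly R[n]}) :
  mmap (@mpolyC n R) (fun i => 'X_i) p = p.
Proof.
by rewrite -[RHS]comp_mpoly_id; apply: eq_mmap => i; rewrite tnth_mktuple.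
Qed.

Lemma muni_eq0 (R : comNzRingType) n (p : {mpoly R[n.+1]}) : (muni p == 0) = (p == 0).
Proof.
apply/eqP/eqP => [p0|->]; last exact: raddf0.
pose u (i : 'I_n) : {mpoly R[n.+1]} := 'X_(lift ord_max i).
have := horner_mmap_muni (@mpolyC n.+1 R) u 'X_ord_max p.
rewrite p0 raddf0 horner0 => E; rewrite -[LHS]mmap_mpolyX [RHS]E.
by apply: eq_mmap => i; rewrite /extend_ord; case: unliftP => [j|] ->.
Qed.

Lemma root_map_poly_dvd (A : nzRingType) (B : idomainType) (f : {rmorphism A -> B})
    (p : {poly A}) b :
  b != 0 -> p != 0 -> root (map_poly f p) b ->
  exists2 a, a != 0 & exists c, f a = b * c.
Proof.
move=> b0; elim/poly_ind: p => [|p a IH] pa0; first by rewrite eqxx in pa0.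
rewrite /root rmorphD rmorphM /= map_polyX map_polyC hornerMXaddC => E.
have [a0|a0] := eqVneq a 0; last first.
  exists a => //; exists (- (map_poly f p).[b]).
  by move: E; rewrite mulrC addrC addr_eq0 mulrN => /eqP.
apply: IH; move: pa0 E; rewrite a0 polyC0 raddf0 !addr0.
  by move=> pX0 _; apply: contraNneq pX0 => ->; rewrite mul0r.
by move=> _; rewrite mulf_eq0 (negPf b0) orbF.
Qed.

Lemma mpoly_elimination (R : fieldType) N (F : N.-tuple {mpoly R[N]}) h : h != 0 ->
  exists2 P : {mpoly R[N]}, P != 0 & exists r, P \mPo F = h * r.
Proof.
move=> h0.
have [Q Q0 Qh] := mpoly_algebraic_dependence (extend_ord (tnth F) h) (ltnSn N).
apply: (@root_map_poly_dvd _ _ (comp_mpoly F) (muni Q)); rewrite ?muni_eq0 //.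
by rewrite /root horner_mmap_muni Qh.
Qed.

Lemma poly_nonroot_seq (R : idomainType) (p : {poly R}) (g : nat -> R) :
  injective g -> p != 0 -> exists i, p.[g i] != 0.
Proof.
move=> gI p0; have := max_poly_roots p0 (rs := map g (iota 0 (size p))).
rewrite size_map size_iota ltnn map_inj_uniq ?iota_uniq //.
case: allP => [_ /(_ isT isT) //|+ _]; apply: contra_notP => np x /mapP[i _ ->].
by apply/rootP; apply: contra_notP np => /eqP ?; exists i.
Qed.

Lemma poly_eq0_itv (R : realFieldType) (p : {poly R}) (a b : R) :
  a < b -> (forall t, a < t -> t < b -> p.[t] = 0) -> p = 0.
Proof.
move=> ab p0; apply/eqP; apply: contraT; pose g i := a + (b - a) / i.+2%:R.
case/(@poly_nonroot_seq _ _ g) => [i j /addrI /(mulfI _)|i]; last rewrite p0 ?eqxx //.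
- by rewrite subr_eq0 gt_eqF // => /(_ isT) /invr_inj/eqP; rewrite eqr_nat => /eqP[].
- by rewrite ltrDl divr_gt0 ?subr_gt0 ?ltr0n.
- by rewrite -ltrBrDl ltr_pdivrMr ?ltr0n // ltr_pMr ?subr_gt0 // ltr1n.
Qed.

Lemma mpoly_neq0_meval (R : numDomainType) n (p : {mpoly R[n]}) :
  p != 0 -> exists v, p.@[v] != 0.
Proof.
elim: n p => [|n IH] p p0.
  have pE : p = (p@_0)%:MP by apply/mpolyP=> m; rewrite nvar0_mnmE mcoeffC eqxx mulr1.
  by exists (fun=> 0); rewrite pE mevalC; apply: contraNneq p0 => c0; rewrite pE c0.
have q0 : lead_coef (muni p) != 0 by rewrite lead_coef_eq0 muni_eq0.
have [v qv] := IH _ q0.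
have [||i] := @poly_nonroot_seq _ (map_poly (meval v) (muni p)) (fun i => i%:R).
- by move=> i j /eqP; rewrite eqr_nat => /eqP.
- apply: contraNneq qv => /(congr1 (coefp (size (muni p)).-1))/eqP.
  by rewrite /= coef0 coef_map.
by exists (extend_ord v i%:R); rewrite /meval -horner_mmap_muni.
Qed.

Section PolynomialFunctions.
Variables (R S : comNzRingType) (V : Type) (ev : V -> {rmorphism S -> R}).
Implicit Types f g : V -> R.

(* [S] is a ring of polynomials and [ev v] the evaluation at the point [v]. *)
Definition polyfun f := exists p, forall v, f v = ev v p.

Lemma polyfunD f g : polyfun f -> polyfun g -> polyfun (fun v => f v + g v).
Proof. by move=> [p fp] [q gq]; exists (p + q) => v; rewrite rmorphD fp gq. Qed.

Lemma polyfunN f : polyfun f -> polyfun (fun v => - f v).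
Proof. by move=> [p fp]; exists (- p) => v; rewrite rmorphN fp. Qed.

Lemma polyfunM f g : polyfun f -> polyfun g -> polyfun (fun v => f v * g v).
Proof. by move=> [p fp] [q gq]; exists (p * q) => v; rewrite rmorphM fp gq. Qed.

Lemma polyfun_nat k : polyfun (fun=> k%:R).
Proof. by exists k%:R => v; rewrite rmorph_nat. Qed.

Definition polymx m n (M : V -> 'M[R]_(m, n)) :=
  exists P : 'M[S]_(m, n), forall v, M v = map_mx (ev v) P.

Lemma polymx_entry m n (M : V -> 'M[R]_(m, n)) i j :
  polymx M -> polyfun (fun v => M v i j).
Proof. by move=> [P MP]; exists (P i j) => v; rewrite MP mxE. Qed.

Lemma polymx_matrix m n (E : V -> 'I_m -> 'I_n -> R) :
  (forall i j, polyfun (fun v => E v i j)) -> polymx (fun v => \matrix_(i, j) E v i j).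
Proof.
move=> E_poly; have /choice[p Ep] (ij : 'I_m * 'I_n) := E_poly ij.1 ij.2.
by exists (\matrix_(i, j) p (i, j)) => v; apply/matrixP=> i j; rewrite !mxE -Ep.
Qed.

Lemma polymx_cst m n (M : 'M[R]_(m, n)) :
  (forall c, polyfun (fun=> c)) -> polymx (fun=> M).
Proof.
move=> /choice[p pE]; exists (map_mx p M) => v; apply/matrixP=> i j.
by rewrite !mxE -pE.
Qed.

Lemma polymxM m n p (M : V -> 'M[R]_(m, n)) (N : V -> 'M[R]_(n, p)) :
  polymx M -> polymx N -> polymx (fun v => M v *m N v).
Proof. by move=> [P MP] [Q NQ]; exists (P *m Q) => v; rewrite map_mxM MP NQ. Qed.

Lemma polymxD m n (M N : V -> 'M[R]_(m, n)) :
  polymx M -> polymx N -> polymx (fun v => M v + N v).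
Proof. by move=> [P MP] [Q NQ]; exists (P + Q) => v; rewrite map_mxD MP NQ. Qed.

Lemma polymxN m n (M : V -> 'M[R]_(m, n)) : polymx M -> polymx (fun v => - M v).
Proof. by move=> [P MP]; exists (- P) => v; rewrite map_mxN MP. Qed.

Lemma polymxZ m n (f : V -> R) (M : V -> 'M[R]_(m, n)) :
  polyfun f -> polymx M -> polymx (fun v => f v *: M v).
Proof. by move=> [p fp] [P MP]; exists (p *: P) => v; rewrite map_mxZ fp MP. Qed.

Lemma polymx_tr m n (M : V -> 'M[R]_(m, n)) : polymx M -> polymx (fun v => (M v)^T).
Proof. by move=> [P MP]; exists P^T => v; rewrite MP map_trmx. Qed.

Lemma polymx_scalar n (f : V -> R) : polyfun f -> polymx (fun v => (f v)%:M : 'M_n).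
Proof. by move=> [p fp]; exists p%:M => v; rewrite map_scalar_mx fp. Qed.

Lemma polymx_sum m n (I : finType) (M : V -> I -> 'M[R]_(m, n)) :
  (forall k, polymx (M^~ k)) -> polymx (fun v => \sum_k M v k).
Proof.
by move=> /choice[P MP]; exists (\sum_k P k) => v; rewrite raddf_sum; apply: eq_bigr.
Qed.

Lemma polyfun_det n (M : V -> 'M[R]_n) : polymx M -> polyfun (fun v => \det (M v)).
Proof. by move=> [P MP]; exists (\det P) => v; rewrite -det_map_mx MP. Qed.

Lemma polymx_adj n (M : V -> 'M[R]_n) : polymx M -> polymx (fun v => \adj (M v)).
Proof. by move=> [P MP]; exists (\adj P) => v; rewrite map_mx_adj MP. Qed.

End PolynomialFunctions.

Section PolynomialFamilies.
Variables (R S : comNzRingType) (V : Type) (ev : V -> {rmorphism S -> R}).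

Definition map_poly_ev (v : V) : {rmorphism {poly S} -> {poly R}} := map_poly (ev v).

Lemma polyfun_polyX : polyfun map_poly_ev (fun=> 'X).
Proof. by exists 'X => v; rewrite /= map_polyX. Qed.

Lemma polymx_polyC m n (M : V -> 'M[R]_(m, n)) :
  polymx ev M -> polymx map_poly_ev (fun v => map_mx polyC (M v)).
Proof.
move=> [P MP]; exists (map_mx polyC P) => v.
by apply/matrixP=> i j; rewrite MP !mxE /= map_polyC.
Qed.

Lemma polymx_horner_mx n (M : V -> 'M[R]_n.+1) (q : V -> {poly R}) :
  polymx ev M -> polyfun map_poly_ev q -> polymx ev (fun v => horner_mx (M v) (q v)).
Proof.
by move=> [P MP] [p qp]; exists (horner_mx P p) => v; rewrite map_horner_mx MP qp.
Qed.

End PolynomialFamilies.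

Section Genericity.
Variables (R : numFieldType) (K : finType).
Implicit Types (f h : (K -> R) -> R) (Q : (K -> R) -> Prop).

Definition meval_fin (v : K -> R) : {rmorphism {mpoly R[#|K|]} -> R} :=
  meval (fun i => v (enum_val i)).

Lemma polyfun_meval_cst c : polyfun meval_fin (fun=> c).
Proof. by exists c%:MP => v; rewrite /= mevalC. Qed.

Lemma polyfun_meval_coord k : polyfun meval_fin (fun v => v k).
Proof. by exists 'X_(enum_rank k) => v; rewrite /= mevalXU enum_rankK. Qed.

Lemma polyfun_comp f (F : (K -> R) -> K -> R) : polyfun meval_fin f ->
  (forall k, polyfun meval_fin (F^~ k)) -> polyfun meval_fin (fun v => f (F v)).
Proof.
move=> [p fp] /choice[q Fq]; exists (p \mPo [tuple q (enum_val i) | i < #|K|]) => v.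
by rewrite fp /= comp_mpoly_meval; apply: meval_eq => i; rewrite tnth_mktuple Fq.
Qed.

Lemma meval_fin_neq0 p : p != 0 <-> exists v, meval_fin v p != 0.
Proof.
split=> [/mpoly_neq0_meval[u pu]|[v]]; last by apply: contraNneq => ->; rewrite rmorph0.
exists (fun k => u (enum_rank k)); rewrite /= (@meval_eq _ _ _ u) // => i.
by rewrite enum_valK.
Qed.

Definition generic Q := exists P : {mpoly R[#|K|]},
  P != 0 /\ forall v, meval_fin v P != 0 -> Q v.

Lemma generic_neq0 f : polyfun meval_fin f -> (exists v, f v != 0) ->
  generic (fun v => f v != 0).
Proof.
move=> [p fp] [v fv]; exists p; split=> [|u]; rewrite ?fp // meval_fin_neq0.
by exists v; rewrite -fp.
Qed.

Lemma generic_sub Q Q' : (forall v, Q v -> Q' v) -> generic Q -> generic Q'.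
Proof. by move=> QQ' [P [P0 PQ]]; exists P; split=> // v /PQ/QQ'. Qed.

Lemma generic_forall (I : finType) (Q : I -> (K -> R) -> Prop) :
  (forall i, generic (Q i)) -> generic (fun v => forall i, Q i v).
Proof.
move=> /choice[P hP]; exists (\prod_i P i); split=> [|v].
  by apply/prodf_neq0 => i _; case: (hP i).
by rewrite rmorph_prod => /prodf_neq0 Pv i; case: (hP i) => _; apply; apply: Pv.
Qed.

Lemma generic_and Q Q' : generic Q -> generic Q' -> generic (fun v => Q v /\ Q' v).
Proof.
move=> gQ gQ'; have [] := @generic_forall _ (fun b : bool => if b then Q else Q').
  by case.
move=> P [P0 PQ]; exists P; split=> // v /PQ Qv.
by split; [apply: Qv true|apply: Qv false].
Qed.

(* The same index set [K] for parameters and values makes [F] a map between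
   spaces of the same dimension. *)
Lemma generic_image (F : (K -> R) -> K -> R) h :
  (forall k, polyfun meval_fin (F^~ k)) -> polyfun meval_fin h -> (exists v, h v != 0) ->
  generic (fun w => forall v, F v =1 w -> h v != 0).
Proof.
move=> /choice[q Fq] [p hp] [v0 hv0].
have p0 : p != 0 by apply/meval_fin_neq0; exists v0; rewrite -hp.
have [P P0 [r Pr]] := mpoly_elimination [tuple q (enum_val i) | i < #|K|] p0.
exists P; split=> // w Pw v Fv; apply: contraNneq Pw => hv; apply/eqP.
have := congr1 (meval_fin v) Pr; rewrite rmorphM -hp hv mul0r /= comp_mpoly_meval => PF.
by rewrite -[RHS]PF; apply: meval_eq => i; rewrite tnth_mktuple -Fv Fq.
Qed.

End Genericity.

(** * Quadratic forms and kernels *)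

Section DotProduct.
Variables (R : comNzRingType) (n : nat).
Implicit Types (c d u v w : 'cV[R]_n) (M : 'M[R]_n).

Definition dot u v : R := (u^T *m v) ord0 ord0.

Lemma dotE u v : dot u v = \sum_i u i ord0 * v i ord0.
Proof. by rewrite /dot mxE; apply: eq_bigr => i _; rewrite mxE. Qed.

Lemma dotC u v : dot u v = dot v u.
Proof. by rewrite !dotE; apply: eq_bigr => i _; rewrite mulrC. Qed.

Lemma dotDr u v w : dot u (v + w) = dot u v + dot u w.
Proof. by rewrite /dot mulmxDr mxE. Qed.

Lemma dotDl u v w : dot (u + v) w = dot u w + dot v w.
Proof. by rewrite dotC dotDr ![dot w _]dotC. Qed.

Lemma dotZr (k : R) u v : dot u (k *: v) = k * dot u v.
Proof. by rewrite /dot -scalemxAr mxE. Qed.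

Lemma dotZl (k : R) u v : dot (k *: u) v = k * dot u v.
Proof. by rewrite dotC dotZr dotC. Qed.

Lemma dot0r u : dot u 0 = 0.
Proof. by rewrite /dot mulmx0 mxE. Qed.

Lemma dotNr u v : dot u (- v) = - dot u v.
Proof. by rewrite -scaleN1r dotZr mulN1r. Qed.

Lemma dotNl u v : dot (- u) v = - dot u v.
Proof. by rewrite dotC dotNr dotC. Qed.

Lemma dot_sumr (I : finType) u (F : I -> 'cV[R]_n) :
  dot u (\sum_i F i) = \sum_i dot u (F i).
Proof. by rewrite /dot mulmx_sumr summxE. Qed.

Lemma dot_trmx M u v : dot u (M *m v) = dot (M^T *m u) v.
Proof. by rewrite /dot trmx_mul trmxK mulmxA. Qed.

Lemma dot_sym M u v : M^T = M -> dot u (M *m v) = dot v (M *m u).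
Proof. by move=> Ms; rewrite dot_trmx Ms dotC. Qed.

Lemma dot_delta i v : dot (delta_mx i ord0) v = v i ord0.
Proof. by rewrite /dot trmx_delta -(rowE i v) mxE. Qed.

Lemma mul_outer c d v : c *m d^T *m v = dot d v *: c.
Proof.
have dv : d^T *m v = (dot d v)%:M by rewrite [LHS]mx11_scalar.
by rewrite -mulmxA dv mul_mx_scalar.
Qed.

Lemma outer_tr d : (d *m d^T)^T = d *m d^T.
Proof. by rewrite trmx_mul trmxK. Qed.

Lemma dot_add_outer M d v : M^T = M -> M *m d = 0 ->
  dot d ((M + d *m d^T) *m v) = dot d v * dot d d.
Proof.
by move=> Ms Md; rewrite mulmxDl mul_outer dotDr dot_sym // Md dot0r add0r dotZr.
Qed.

(* Sylvester's identity: compare the two triangular factorizations of the block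
   matrix [1, v^T; u, 1]. *)
Lemma det_rank1 u v : \det (1%:M - u *m v^T) = 1 - dot v u.
Proof.
have lower : block_mx 1%:M v^T u 1%:M =
    block_mx (1%:M : 'M[R]_1) 0 u 1%:M *m block_mx 1%:M v^T 0 (1%:M - u *m v^T).
  by rewrite mulmx_block !mul1mx !mul0mx !mulmx1 !addr0 [_ + (_ - _)]addrC subrK.
have upper : block_mx 1%:M v^T u 1%:M =
    block_mx ((1 - dot v u)%:M : 'M[R]_1) v^T 0 1%:M *m block_mx 1%:M 0 u 1%:M.
  rewrite mulmx_block ?mul1mx ?mul0mx ?mulmx0 ?mulmx1 ?add0r; congr block_mx.
  by rewrite [v^T *m u]mx11_scalar -raddfD /= subrK.
have := congr1 determinant lower; rewrite upper.
by rewrite !det_mulmx !det_ublock !det_lblock !det1 !mulr1 !mul1r det_scalar1.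
Qed.

End DotProduct.

Lemma polyfun_dot (R S : comNzRingType) (V : Type) (ev : V -> {rmorphism S -> R}) n
    (u w : V -> 'cV[R]_n) :
  polymx ev u -> polymx ev w -> polyfun ev (fun v => dot (u v) (w v)).
Proof. by move=> u_poly w_poly; apply/polymx_entry/polymxM/w_poly/polymx_tr. Qed.

Section Kernels.
Variables (F : fieldType) (n : nat).
Implicit Types (M : 'M[F]_n) (b c d v : 'cV[F]_n).

Lemma nonunitmx_ker M : M \notin unitmx -> exists2 v : 'cV_n, v != 0 & M *m v = 0.
Proof.
rewrite unitmxE unitfE negbK -det_tr => /det0P[v v0 vM]; exists v^T.
  by rewrite trmx_eq0.
by rewrite -[M]trmxK -trmx_mul vM trmx0.
Qed.

Lemma unitmx_kerP M : reflect (forall v, M *m v = 0 -> v = 0) (M \in unitmx).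
Proof.
apply: (iffP idP) => [Mu v Mv|ker0]; first by rewrite -[v](mulKmx Mu) Mv mulmx0.
by apply/negPn/negP => /nonunitmx_ker[v /eqP v0 /ker0].
Qed.

Lemma det_sub_outer M b c : M \in unitmx ->
  \det (M - b *m c^T) = \det M - dot c (\adj M *m b).
Proof.
move=> Mu; have -> : M - b *m c^T = M *m (1%:M - (invmx M *m b) *m c^T).
  by rewrite mulmxBr mulmx1 !mulmxA mulmxV // mul1mx.
rewrite det_mulmx det_rank1 mulrBr mulr1 -dotZr -{2}[b](mulKVmx Mu).
by rewrite [\adj M *m _]mulmxA mul_adj_mx mul_scalar_mx.
Qed.

Definition kernel_in_line M d := forall v, M *m v = 0 -> exists k, v = k *: d.

Lemma kernel_in_lineZ k M d : k != 0 -> kernel_in_line (k *: M) d -> kernel_in_line M d.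
Proof. by move=> k0 ker v Mv; apply: ker; rewrite -scalemxAl Mv scaler0. Qed.

Lemma kernel_in_line_rank1 M b c d :
  M *m d = 0 -> d != 0 -> M + c *m b^T \in unitmx -> kernel_in_line M d.
Proof.
move=> Md d0 /unitmx_kerP ker0.
have bd : dot b d != 0.
  apply: contraNneq d0 => bd; apply/eqP/ker0.
  by rewrite mulmxDl Md mul_outer bd scale0r addr0.
move=> v Mv; exists (dot b v / dot b d); apply/subr0_eq/ker0.
rewrite mulmxDl mul_outer mulmxBr Mv -scalemxAr Md scaler0 subrr add0r.
by rewrite dotDr dotNr dotZr divfK // subrr scale0r.
Qed.

End Kernels.

Section QuadraticForms.
Variables (R : realFieldType) (n : nat).
Implicit Types (M : 'M[R]_n) (d u v : 'cV[R]_n).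

Lemma dot_ge0 u : 0 <= dot u u.
Proof. by rewrite dotE; apply: sumr_ge0 => i _; rewrite -expr2 sqr_ge0. Qed.

Lemma dot_eq0 u : (dot u u == 0) = (u == 0).
Proof.
apply/eqP/eqP => [|->]; last exact: dot0r.
rewrite dotE => /eqP; rewrite psumr_eq0 => [/allP u0|i _]; last by rewrite -expr2 sqr_ge0.
apply/colP=> i; rewrite mxE; apply/eqP.
by have := u0 i (mem_index_enum i); rewrite mulf_eq0 orbb.
Qed.

Lemma dot_gt0 u : u != 0 -> 0 < dot u u.
Proof. by rewrite -dot_eq0 lt_neqAle dot_ge0 andbT eq_sym. Qed.

Lemma unitmx_add_outer M d : M^T = M -> M *m d = 0 -> d != 0 ->
  kernel_in_line M d -> M + d *m d^T \in unitmx.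
Proof.
move=> Ms Md d0 ker; apply/unitmx_kerP=> v Nv.
have dv : dot d v = 0.
  have /esym/eqP := dot_add_outer v Ms Md; rewrite Nv dot0r.
  by rewrite mulf_eq0 dot_eq0 (negPf d0) orbF => /eqP.
have [k vE] : exists k, v = k *: d.
  by apply: ker; rewrite -Nv mulmxDl mul_outer dv scale0r addr0.
move/eqP: dv; rewrite vE dotZr mulf_eq0 dot_eq0 (negPf d0) orbF => /eqP ->.
by rewrite scale0r.
Qed.

Definition psd M := forall v, 0 <= dot v (M *m v).

Lemma psd_kernel M v : M^T = M -> psd M -> dot v (M *m v) = 0 -> M *m v = 0.
Proof.
move=> Ms Mp v0; apply/eqP; rewrite -dot_eq0; set y := M *m v; set k := dot y y.
set c := dot y (M *m y); have c0 : 0 <= c := Mp y.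
have k0 : 0 <= k := dot_ge0 y.
have yv : dot v (M *m y) = k by rewrite dot_sym.
pose s := k / (c + 1).
have sE : s * (c + 1) = k by rewrite divfK // gt_eqF // ltr_wpDl.
have s0 : 0 <= s by rewrite divr_ge0 // addr_ge0.
have := Mp (v - s *: y); apply/contraLR => k_neq0.
rewrite mulmxBr -scalemxAr !(dotDl, dotDr, dotNl, dotNr, dotZl, dotZr) v0 -/y -/k -/c yv.
have {k0 k_neq0} k0 : 0 < k by rewrite lt_neqAle eq_sym k_neq0.
by rewrite -ltNge; nra.
Qed.

End QuadraticForms.

Section PositiveDefiniteMatrices.
Variables (R : realType) (n : nat).
Implicit Types (M : 'M[R]_n) (c d u v : 'cV[R]_n).

Lemma sqnormE u : sqnorm u = dot u u.
Proof. by rewrite dotE; apply: eq_bigr => i _; rewrite expr2. Qed.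

Lemma posdefE M : posdef M <-> forall v, v != 0 -> 0 < dot v (M *m v).
Proof. by split=> Mp v v0; have := Mp v v0; rewrite /dot mulmxA. Qed.

Lemma posdef_psd M : posdef M -> psd M.
Proof.
move/posdefE => Mp v; have [->|/Mp/ltW //] := eqVneq v 0.
by rewrite mulmx0 dot0r.
Qed.

Lemma posdef_unitmx M : posdef M -> M \in unitmx.
Proof.
move/posdefE => Mp; apply/unitmx_kerP=> v Mv; apply/eqP; apply: contraT => /Mp.
by rewrite Mv dot0r ltxx.
Qed.

Lemma psd_unitmx_posdef M : M^T = M -> psd M -> M \in unitmx -> posdef M.
Proof.
move=> Ms Mp /unitmx_kerP ker0; apply/posdefE => v v0.
rewrite lt_neqAle Mp andbT eq_sym; apply: contraNneq v0 => /(psd_kernel Ms Mp).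
by move/ker0 ->.
Qed.

Lemma posdef_add_outer M d : M^T = M -> psd M -> kernel_in_line M d ->
  posdef (M + d *m d^T).
Proof.
move=> Ms Mp ker; apply/posdefE => v v0.
rewrite mulmxDl mul_outer dotDr dotZr [dot v d]dotC.
rewrite lt_neqAle addr_ge0 ?Mp -?expr2 ?sqr_ge0 // andbT eq_sym.
apply: contra v0; rewrite paddr_eq0 ?Mp ?sqr_ge0 // => /andP[].
move=> /eqP/(psd_kernel Ms Mp)/ker[k ->].
rewrite dotZr expf_eq0 /= mulf_eq0 dot_eq0.
by case/orP => /eqP ->; rewrite ?scale0r ?scaler0.
Qed.

(* [M] only has to be tested on the hyperplane orthogonal to [c], since that is
   transverse to the kernel vector [d]; there the outer product vanishes. *)
Lemma psd_of_posdef_add_outer M c d : M^T = M -> M *m d = 0 -> dot c d != 0 ->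
  posdef (M + c *m c^T) -> psd M.
Proof.
move=> Ms Md cd /posdef_psd Np w; pose k := dot c w / dot c d; pose y := w - k *: d.
have wE : w = y + k *: d by rewrite subrK.
have cy : dot c y = 0 by rewrite dotDr dotNr dotZr divfK // subrr.
have Mw : M *m w = M *m y by rewrite wE mulmxDr -scalemxAr Md scaler0 addr0.
rewrite Mw wE dotDl dotZl [dot d _]dot_sym // Md dot0r mulr0 addr0.
by have := Np y; rewrite mulmxDl mul_outer cy scale0r addr0.
Qed.

End PositiveDefiniteMatrices.

Section MatrixNorm.
Variables (R : numDomainType) (m n : nat).
Implicit Types M N : 'M[R]_(m, n).

Definition l1norm M : R := \sum_i \sum_j `|M i j|.

Lemma l1norm_ge0 M : 0 <= l1norm M.
Proof. by apply: sumr_ge0 => i _; apply: sumr_ge0. Qed.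

Lemma l1normZ (k : R) M : l1norm (k *: M) = `|k| * l1norm M.
Proof.
rewrite mulr_sumr; apply: eq_bigr => i _; rewrite mulr_sumr.
by apply: eq_bigr => j _; rewrite mxE normrM.
Qed.

Lemma ler_l1norm_sum (I : finType) (F : I -> 'M[R]_(m, n)) :
  l1norm (\sum_k F k) <= \sum_k l1norm (F k).
Proof.
rewrite exchange_big; apply: ler_sum => i _; rewrite exchange_big.
by apply: ler_sum => j _; rewrite summxE ler_norm_sum.
Qed.

End MatrixNorm.

Section QuadraticFormBounds.
Variables (R : realFieldType) (n : nat).
Implicit Types (M N : 'M[R]_n) (u v : 'cV[R]_n).

Lemma ler_normM_dot v i j : `|v i ord0 * v j ord0| <= dot v v.
Proof.
have sqr_le k : v k ord0 ^+ 2 <= dot v v.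
  rewrite dotE (bigD1 k) //= expr2 lerDl; apply: sumr_ge0 => l _.
  by rewrite -expr2 sqr_ge0.
have := sqr_le i; have := sqr_le j; rewrite normrM.
rewrite -(real_normK (num_real (v i ord0))) -(real_normK (num_real (v j ord0))).
by move: `|v i ord0| `|v j ord0| => a b; nra.
Qed.

Lemma ler_norm_quadform M v : `|dot v (M *m v)| <= l1norm M * dot v v.
Proof.
rewrite dotE mulr_suml; apply: le_trans (ler_norm_sum _ _ _) _; apply: ler_sum => i _.
rewrite mxE mulr_sumr mulr_suml; apply: le_trans (ler_norm_sum _ _ _) _.
by apply: ler_sum => j _; rewrite mulrCA normrM ler_wpM2l ?normr_ge0 ?ler_normM_dot.
Qed.

Lemma ler_dot_mulmx M v : dot (M *m v) (M *m v) <= l1norm (M^T *m M) * dot v v.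
Proof.
have -> : dot (M *m v) (M *m v) = dot v (M^T *m M *m v) by rewrite dot_trmx dotC mulmxA.
exact: le_trans (ler_norm _) (ler_norm_quadform _ _).
Qed.

Lemma psd_closed N :
  (forall e, 0 < e -> exists2 N', psd N' & l1norm (N' - N) <= e) -> psd N.
Proof.
move=> approx v; rewrite leNgt; apply/negP => q0; have v0 := dot_ge0 v.
have [|N' N'p N'e] := approx (- dot v (N *m v) / (dot v v + 1)).
  by rewrite divr_gt0 ?oppr_gt0 // ltr_wpDl.
have := N'p v; rewrite -[N'](subrK N) mulmxDl dotDr.
have := le_trans (ler_norm_quadform (N' - N) v) (ler_wpM2r v0 N'e).
rewrite ler_norml mulrAC -mulrA => /andP[_].
have : dot v v / (dot v v + 1) < 1 by rewrite ltr_pdivrMr ?ltr_wpDl // mul1r ltrDl.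
by move: (dot v v / _) => r; nra.
Qed.

Lemma sym_neq0_quadform N : N^T = N -> N != 0 -> exists v, dot v (N *m v) != 0.
Proof.
move=> Ns; apply: contra_neqP => no_v; apply/matrixP => i j.
have Nv v : N *m v = 0.
  have q0 u : dot u (N *m u) = 0 by apply: contra_notP no_v => /eqP; exists u.
  by apply: psd_kernel => // u; rewrite q0.
have := congr1 (dot (delta_mx i ord0)) (Nv (delta_mx j ord0)).
by rewrite dot_delta -colE !mxE dot0r.
Qed.

End QuadraticFormBounds.

Section PositiveDefiniteStability.
Variables (R : realType) (n : nat).
Implicit Types (N : 'M[R]_n) (v : 'cV[R]_n).

(* The value at [v - k N^-1 v] is nonnegative; this avoids any compactness
   argument. *)
Lemma posdef_coercive N : N^T = N -> posdef N ->
  exists2 c, 0 < c & forall v, c * dot v v <= dot v (N *m v).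
Proof.
move=> Ns Np; have Nu := posdef_unitmx Np; pose K := l1norm (invmx N) + 1.
have K0 : 0 < K by rewrite ltr_wpDl ?l1norm_ge0.
exists K^-1; rewrite ?invr_gt0 // => v; pose y := invmx N *m v.
have Ny : N *m y = v by rewrite mulKVmx.
have yv : dot y v <= K * dot v v.
  rewrite dotC; apply: le_trans (ler_norm _) (le_trans (ler_norm_quadform _ _) _).
  by rewrite ler_wpM2r ?dot_ge0 // lerDl.
have := posdef_psd Np (v - K^-1 *: y).
rewrite mulmxBr -scalemxAr Ny !(dotDl, dotDr, dotNl, dotNr, dotZl, dotZr).
rewrite [dot y (N *m v)]dot_sym // Ny.
have : K^-1 * (K^-1 * dot y v) <= K^-1 * dot v v.
  by rewrite ler_pM2l ?invr_gt0 // mulrC ler_pdivrMr // mulrC.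
lra.
Qed.

Lemma posdef_open N : N^T = N -> posdef N ->
  exists2 e, 0 < e & forall N', l1norm (N' - N) <= e -> posdef N'.
Proof.
move=> Ns /(posdef_coercive Ns)[c c0 coercive].
exists (c / 2); rewrite ?divr_gt0 // => N' N'e.
apply/posdefE => v /dot_gt0 v0; rewrite -[N'](subrK N) mulmxDl dotDr.
have := le_trans (ler_norm_quadform (N' - N) v) (ler_wpM2r (ltW v0) N'e).
rewrite ler_norml => /andP[+ _]; have := coercive v.
by have := mulr_gt0 c0 v0; lra.
Qed.

Lemma critical_pencil_pos N v0 : N^T = N -> 0 < dot v0 (N *m v0) ->
  exists2 t, psd (1%:M - t *: N) & 1%:M - t *: N \notin unitmx.
Proof.
move=> Ns v0_pos.
have form_pencil t v : dot v ((1%:M - t *: N) *m v) = dot v v - t * dot v (N *m v).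
  by rewrite mulmxBl mul1mx -scalemxAl dotDr dotNr dotZr.
pose T := [set t : R | psd (1%:M - t *: N)]%classic.
have T0 : T 0 by move=> v; rewrite form_pencil mul0r subr0 dot_ge0.
have Tub v : 0 < dot v (N *m v) -> ubound T (dot v v / dot v (N *m v)).
  by move=> v_pos t /(_ v); rewrite form_pencil subr_ge0 ler_pdivlMr.
have Tsup : has_sup T by split; [exists 0|exists (dot v0 v0 / dot v0 (N *m v0)); apply: Tub].
have psd_sup : psd (1%:M - sup T *: N).
  have s0 : 0 <= sup T by apply: sup_upper_bound.
  move=> v; rewrite form_pencil subr_ge0; have [v_pos|v_npos] := ltP 0 (dot v (N *m v)).
    by rewrite -ler_pdivlMr //; apply: sup_le_ub; [exists 0|apply: Tub].
  by apply: le_trans (dot_ge0 v); rewrite mulr_ge0_le0.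
exists (sup T) => //; apply/negP => unit_sup.
have sym_sup : (1%:M - sup T *: N)^T = 1%:M - sup T *: N.
  by rewrite linearB /= linearZ /= trmx1 Ns.
have [e e0 near_sup] := posdef_open sym_sup (psd_unitmx_posdef sym_sup psd_sup unit_sup).
have K0 : 0 < l1norm N + 1 by rewrite ltr_wpDl ?l1norm_ge0.
have eK0 : 0 < e / (l1norm N + 1) by rewrite divr_gt0.
have /(sup_upper_bound Tsup) : T (sup T + e / (l1norm N + 1)).
  apply/posdef_psd/near_sup.
  rewrite opprB addrC addrA subrK -scalerBl opprD addrA subrr add0r l1normZ normrN.
  by rewrite gtr0_norm // mulrAC ler_pdivrMr // ler_pM2l // lerDl.
by rewrite gerDl leNgt eK0.
Qed.

Lemma critical_pencil N : N^T = N -> N != 0 ->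
  exists2 t, psd (1%:M - t *: N) & 1%:M - t *: N \notin unitmx.
Proof.
move=> Ns /(sym_neq0_quadform Ns)[v].
rewrite neq_lt => /orP[v_neg|]; last exact: critical_pencil_pos.
have NNs : (- N)^T = - N by rewrite linearN /= Ns.
have [|t] := @critical_pencil_pos (- N) v NNs; first by rewrite mulNmx dotNr oppr_gt0.
by rewrite scalerN -scaleNr; exists (- t).
Qed.

End PositiveDefiniteStability.

(** * Pencils and the boundary of the spectrahedron *)

Section Pencils.
Variables (R : comNzRingType) (n : nat) (A : 'I_n -> 'M[R]_n).
Implicit Types lam mu d v : 'cV[R]_n.

Definition lcomb lam : 'M[R]_n := \sum_j lam j ord0 *: A j.
Definition pencil lam : 'M[R]_n := 1%:M - lcomb lam.
Definition lcomb_at d : 'M[R]_n := \matrix_(i, j) (A j *m d) i ord0.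

Lemma lcombD lam mu : lcomb (lam + mu) = lcomb lam + lcomb mu.
Proof. by rewrite -big_split; apply: eq_bigr => i _; rewrite mxE scalerDl. Qed.

Lemma lcombZ (k : R) lam : lcomb (k *: lam) = k *: lcomb lam.
Proof. by rewrite scaler_sumr; apply: eq_bigr => i _; rewrite mxE scalerA. Qed.

Lemma lcombB lam mu : lcomb (lam - mu) = lcomb lam - lcomb mu.
Proof. by rewrite lcombD -scaleN1r lcombZ scaleN1r. Qed.

Lemma lcomb_delta j : lcomb (delta_mx j ord0) = A j.
Proof.
rewrite /lcomb (bigD1 j) //= mxE !eqxx scale1r big1 ?addr0 // => i /negPf ij.
by rewrite mxE ij scale0r.
Qed.

Lemma lcomb_mul lam v : lcomb lam *m v = lcomb_at v *m lam.
Proof.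
apply/colP=> i; rewrite mulmx_suml summxE mxE; apply: eq_bigr => j _.
by rewrite -scalemxAl mxE [lcomb_at _ _ _]mxE mulrC.
Qed.

Lemma lcomb_atD d v : lcomb_at (d + v) = lcomb_at d + lcomb_at v.
Proof.
apply/matrixP=> i j; rewrite !mxE -big_split; apply: eq_bigr => k _.
by rewrite mxE mulrDr.
Qed.

Lemma lcomb_atZ (k : R) d : lcomb_at (k *: d) = k *: lcomb_at d.
Proof.
apply/matrixP=> i j; rewrite !mxE mulr_sumr; apply: eq_bigr => l _.
by rewrite mxE mulrCA.
Qed.

Lemma pencil_mul lam v : pencil lam *m v = v - lcomb_at v *m lam.
Proof. by rewrite mulmxBl mul1mx lcomb_mul. Qed.

Lemma pencilB lam mu : pencil mu - pencil lam = lcomb (lam - mu).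
Proof. by rewrite lcombB opprB addrC addrA subrK. Qed.

Lemma pencil_line lam mu (t : R) : pencil (lam + t *: mu) = pencil lam - t *: lcomb mu.
Proof. by rewrite /pencil lcombD lcombZ opprD addrA. Qed.

Lemma pencil_tr lam : (forall j, (A j)^T = A j) -> (pencil lam)^T = pencil lam.
Proof.
move=> As; rewrite /pencil linearB /= trmx1 linear_sum; congr (_ - _).
by apply: eq_bigr => j _; rewrite linearZ /= As.
Qed.

End Pencils.

Lemma map_lcomb_at (R S : comNzRingType) (f : {rmorphism R -> S}) n
    (A : 'I_n -> 'M[R]_n) (d : 'cV[R]_n) :
  map_mx f (lcomb_at A d) = lcomb_at (fun j => map_mx f (A j)) (map_mx f d).
Proof.
apply/matrixP=> i j; rewrite !mxE rmorph_sum; apply: eq_bigr => k _.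
by rewrite !mxE rmorphM.
Qed.

Section PolynomialPencils.
Variables (R S : comNzRingType) (V : Type) (ev : V -> {rmorphism S -> R}) (n : nat).
Variables (A : V -> 'I_n -> 'M[R]_n) (d : V -> 'cV[R]_n).
Hypotheses (A_poly : forall j, polymx ev (A^~ j)) (d_poly : polymx ev d).

Lemma polymx_lcomb_at : polymx ev (fun v => lcomb_at (A v) (d v)).
Proof. by apply: polymx_matrix => i j; apply/polymx_entry/polymxM. Qed.

Lemma polymx_lcomb : polymx ev (fun v => lcomb (A v) (d v)).
Proof. by apply: polymx_sum => j; apply: polymxZ => //; apply: polymx_entry. Qed.

Lemma polymx_pencil : polymx ev (fun v => pencil (A v) (d v)).
Proof.
apply: polymxD; last exact/polymxN/polymx_lcomb.
by exists 1%:M => v; rewrite map_mx1.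
Qed.

End PolynomialPencils.

Section SingularPencils.
Variables (F : fieldType) (n : nat) (A : 'I_n -> 'M[F]_n).
Implicit Types d lam : 'cV[F]_n.

(* The rational parametrization of the hypersurface [\det (pencil A lam) = 0] by
   the kernel of [pencil A lam]. *)
Definition lam_killing d : 'cV[F]_n := invmx (lcomb_at A d) *m d.

Lemma lam_killingE d : lcomb_at A d \in unitmx -> lcomb_at A d *m lam_killing d = d.
Proof. by move=> Bu; rewrite mulKVmx. Qed.

Lemma pencil_lam_killing d : lcomb_at A d \in unitmx -> pencil A (lam_killing d) *m d = 0.
Proof. by move=> Bu; rewrite pencil_mul lam_killingE // subrr. Qed.

Lemma lam_killing_uniq d lam : lcomb_at A d \in unitmx ->
  pencil A lam *m d = 0 -> lam = lam_killing d.
Proof.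
move=> Bu; rewrite pencil_mul => /subr0_eq dE.
by rewrite /lam_killing [X in _ *m X]dE mulKmx.
Qed.

Lemma lcomb_at_unitZ k d : k != 0 ->
  (lcomb_at A (k *: d) \in unitmx) = (lcomb_at A d \in unitmx).
Proof. by move=> k0; rewrite lcomb_atZ unitmxZ ?unitfE. Qed.

Lemma lam_killingZ k d : k != 0 -> lcomb_at A d \in unitmx ->
  lam_killing (k *: d) = lam_killing d.
Proof.
move=> k0 Bu; apply/esym/lam_killing_uniq; first by rewrite lcomb_at_unitZ.
by rewrite -scalemxAr pencil_lam_killing ?scaler0.
Qed.

Definition regular_kernel d :=
  [/\ d != 0, lcomb_at A d \in unitmx & kernel_in_line (pencil A (lam_killing d)) d].

Lemma regular_kernelZ k d : k != 0 -> regular_kernel d -> regular_kernel (k *: d).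
Proof.
move=> k0 [d0 Bu ker]; split; first by rewrite scaler_eq0 negb_or k0.
  by rewrite lcomb_at_unitZ.
by move=> v; rewrite lam_killingZ // => /ker[c ->]; exists (c / k); rewrite scalerA divfK.
Qed.

End SingularPencils.

Section SpectrahedronBoundary.
Variables (R : realType) (n : nat) (A : 'I_n -> 'M[R]_n).
Implicit Types lam mu v : 'cV[R]_n.

Lemma pencil_continuous e : 0 < e -> exists2 r, 0 < r &
  forall lam mu, (forall j, `|mu j ord0 - lam j ord0| <= r) ->
    l1norm (pencil A mu - pencil A lam) <= e.
Proof.
move=> e0; pose K := \sum_j l1norm (A j) + 1.
have K0 : 0 < K by rewrite ltr_wpDl // sumr_ge0 // => j _; apply: l1norm_ge0.
have r0 : 0 < e / K by rewrite divr_gt0.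
exists (e / K) => // lam mu close; rewrite pencilB; apply: le_trans (ler_l1norm_sum _) _.
apply: le_trans (_ : \sum_j e / K * l1norm (A j) <= _).
  apply: ler_sum => j _; rewrite l1normZ ler_wpM2r ?l1norm_ge0 //.
  by have := close j; rewrite !mxE distrC.
by rewrite -mulr_sumr mulrAC ler_pdivrMr // ler_pM2l // lerDl.
Qed.

Lemma ler_norm_coord v i (r : R) : 0 < r -> sqnorm v < r ^+ 2 -> `|v i ord0| <= r.
Proof.
move=> r0 vr; have := ler_normM_dot v i i; rewrite -sqnormE normrM.
by have := normr_ge0 (v i ord0); nra.
Qed.

Lemma topbd_Sed lam : (forall j, (A j)^T = A j) ->
  topbd (Sed A) lam -> psd (pencil A lam) /\ pencil A lam \notin unitmx.
Proof.
move=> As bd; have near r mu : 0 < r -> sqnorm (mu - lam) < r ^+ 2 ->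
    forall j, `|mu j ord0 - lam j ord0| <= r.
  by move=> r0 /ler_norm_coord close j; have := close j r0; rewrite !mxE.
have psd_lam : psd (pencil A lam).
  apply: psd_closed => e /pencil_continuous[r r0 cont].
  have [[mu [Smu close]] _] := bd r r0.
  by exists (pencil A mu); [apply: posdef_psd|apply/cont/near].
split=> //; apply/negP => unit_lam; have sym_lam := pencil_tr lam As.
have [e e0 open] := posdef_open sym_lam (psd_unitmx_posdef sym_lam psd_lam unit_lam).
have [r r0 cont] := pencil_continuous e0; have [_ [mu [nSmu close]]] := bd r r0.
exact/nSmu/open/cont/near.
Qed.

(* The points [(1 - s) lam], for small [s > 0], are in the interior. *)
Lemma psd_singular_topbd_Sed lam :
  psd (pencil A lam) -> pencil A lam \notin unitmx -> topbd (Sed A) lam.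
Proof.
move=> psd_lam sing_lam e e0; split; last first.
  exists lam; split; last by rewrite subrr sqnormE dot0r exprn_gt0.
  by move/posdef_unitmx; apply/negP.
pose K := dot lam lam + 1; pose s := Num.min 1 (e / K).
have K0 : 0 < K by rewrite ltr_wpDl // dot_ge0.
have s0 : 0 < s by rewrite lt_min ltr01 divr_gt0.
have s1 : s <= 1 by rewrite ge_min lexx.
have sK : s * K <= e by rewrite -ler_pdivlMr // ge_min lexx orbT.
exists ((1 - s) *: lam); split.
  apply/posdefE => v /dot_gt0 v0; have := psd_lam v.
  rewrite -/(pencil A _) !pencil_mul -scalemxAr !dotDr !dotNr dotZr; nra.
rewrite -{2}[lam]scale1r -scalerBl sqnormE dotZl dotZr addrAC subrr add0r mulrA mulrNN.
have : (s * K) ^+ 2 <= e ^+ 2 by apply: lerXn2r; rewrite // nnegrE ltW // mulr_gt0.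
apply: lt_le_trans; rewrite exprMn expr2 ltr_pM2l ?mulr_gt0 //.
by rewrite /K; have := dot_ge0 lam; nra.
Qed.

End SpectrahedronBoundary.

(** * First-order jets of rational functions *)

Section NearZero.
Variable R : realFieldType.
Implicit Types Q : R -> Prop.

Definition near0 Q := exists2 r, 0 < r & forall t, `|t| < r -> Q t.

Lemma near0_sub Q Q' : (forall t, Q t -> Q' t) -> near0 Q -> near0 Q'.
Proof. by move=> QQ' [r r0 Qr]; exists r => // t /Qr/QQ'. Qed.

Lemma near0_and Q Q' : near0 Q -> near0 Q' -> near0 (fun t => Q t /\ Q' t).
Proof.
move=> [r r0 Qr] [r' r0' Qr']; exists (Num.min r r'); first by rewrite lt_min r0.
by move=> t; rewrite lt_min => /andP[/Qr ? /Qr'].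
Qed.

Lemma near0_forall (I : finType) (Q : I -> R -> Prop) :
  (forall i, near0 (Q i)) -> near0 (fun t => forall i, Q i t).
Proof.
move=> near_Q; suff [r r0 Qr] : near0 (fun t => forall i, i \in enum I -> Q i t).
  by exists r => // t /Qr Qt i; apply: Qt; rewrite mem_enum.
elim: (enum I) => [|i s IH]; first by exists 1.
have := near0_and (near_Q i) IH; apply: near0_sub => t [Qi Qs] j.
by rewrite inE => /predU1P[->|/Qs].
Qed.

End NearZero.

Section Jets.
Variable R : rcfType.
Implicit Types (f g h : R -> R) (a b c d e : R).

Definition horner_ev (t : R) : {rmorphism {poly R} -> R} := horner_eval t.

Lemma polyfun_horner_id : polyfun horner_ev id.
Proof. by exists 'X => t; rewrite /= /horner_eval hornerX. Qed.

Lemma polyfun_horner_cst c : polyfun horner_ev (fun=> c).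
Proof. by exists c%:P => t; rewrite /= /horner_eval hornerC. Qed.

Lemma polymx_horner_cst m n (M : 'M[R]_(m, n)) : polymx horner_ev (fun=> M).
Proof. exact/polymx_cst/polyfun_horner_cst. Qed.

Lemma polymx_ray m n (M N : 'M[R]_(m, n)) : polymx horner_ev (fun t => M + t *: N).
Proof.
by apply: polymxD; [|apply: polymxZ polyfun_horner_id _]; apply: polymx_horner_cst.
Qed.

(* [f] coincides with [a + b t + O(t^2)], the remainder being a rational
   function regular at 0; at the poles the identity holds trivially. *)
Definition jet f (a b : R) := exists e q : {poly R},
  e.[0] != 0 /\ forall t, f t * e.[t] = (a + b * t) * e.[t] + t ^+ 2 * q.[t].

Lemma eq_jet f g a b : f =1 g -> jet f a b -> jet g a b.
Proof. by move=> fg [e [q [e0 fE]]]; exists e, q; split=> // t; rewrite -fg. Qed.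

Lemma jet_line a b : jet (fun t => a + b * t) a b.
Proof. by exists 1, 0; split=> [|t]; rewrite !hornerE ?oner_neq0. Qed.

Lemma jet_cst a : jet (fun=> a) a 0.
Proof. by apply: eq_jet (jet_line a 0) => t; rewrite mul0r addr0. Qed.

Lemma jetD f g a b c d : jet f a b -> jet g c d -> jet (fun t => f t + g t) (a + c) (b + d).
Proof.
move=> [e1 [q1 [e10 fE]]] [e2 [q2 [e20 gE]]].
exists (e1 * e2), (q1 * e2 + q2 * e1); split=> [|t]; first by rewrite hornerM mulf_neq0.
have -> : (f t + g t) * (e1 * e2).[t] = f t * e1.[t] * e2.[t] + g t * e2.[t] * e1.[t].
  by rewrite hornerM; ring.
by rewrite fE gE hornerD !hornerM; ring.
Qed.

Lemma jetM f g a b c d : jet f a b -> jet g c d ->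
  jet (fun t => f t * g t) (a * c) (b * c + a * d).
Proof.
move=> [e1 [q1 [e10 fE]]] [e2 [q2 [e20 gE]]].
exists (e1 * e2), ((a%:P + b *: 'X) * e1 * q2 + q1 * (c%:P + d *: 'X) * e2 + 'X^2 * q1 * q2
  + (b * d) *: (e1 * e2)).
split=> [|t]; first by rewrite hornerM mulf_neq0.
have -> : f t * g t * (e1 * e2).[t] = f t * e1.[t] * (g t * e2.[t]).
  by rewrite hornerM; ring.
by rewrite fE gE !(hornerD, hornerM, hornerZ, hornerX, hornerC, hornerXn); ring.
Qed.

Lemma jet_quotient f h k a b :
  polyfun horner_ev h -> polyfun horner_ev k -> h 0 != 0 ->
  (forall t, h t != 0 -> f t * h t = (a + b * t) * h t + t ^+ 2 * k t) -> jet f a b.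
Proof.
move=> [e hE] [q kE] h0 fE; exists (e * e), (e * q).
have eE t : e.[t] = h t by rewrite hE.
have qE t : q.[t] = k t by rewrite kE.
split=> [|t]; rewrite !hornerM !eE ?qE ?mulf_neq0 //.
have [->|/fE ft] := eqVneq (h t) 0; first by rewrite !mul0r !mulr0 addr0.
by rewrite mulrA ft; ring.
Qed.

Lemma polyfun_factor f : polyfun horner_ev f ->
  exists2 g, polyfun horner_ev g & forall t, f t = f 0 + t * g t.
Proof.
move=> [p fp]; have /factor_theorem[q pq] : root (p - p.[0]%:P) 0.
  by rewrite /root !hornerE subrr.
exists (horner_ev^~ q) => [|t]; first by exists q.
rewrite !fp /= /horner_eval mulrC; apply/eqP; rewrite addrC -subr_eq; apply/eqP.
by have := congr1 (horner_eval t) pq; rewrite /horner_eval !hornerE subr0.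
Qed.

Lemma jet_polyfun f : polyfun horner_ev f -> exists b, jet f (f 0) b.
Proof.
move=> /polyfun_factor[g /polyfun_factor[h [p hp] gE] fE]; exists (g 0), 1, p.
by split=> [|t]; rewrite hornerC ?oner_neq0 // fE gE hp /= /horner_eval; ring.
Qed.

Lemma jet_near f a b e : jet f a b -> 0 < e -> near0 (fun t => `|f t - a| < e).
Proof.
move=> [d [q [d0 fE]]] e0; have d0' : 0 < `|d.[0]| / 2 by rewrite divr_gt0 ?normr_gt0.
have [r r0 d_near] := poly_cont 0 d d0'.
have [s s0 g_near] := poly_cont 0 (b *: ('X * d) + 'X^2 * q) (mulr_gt0 e0 d0').
exists (Num.min r s); rewrite ?lt_min ?r0 // => t.
rewrite lt_min => /andP[tr ts].
have := d_near t; rewrite subr0 => /(_ tr) dt; have := g_near t; rewrite subr0 => /(_ ts).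
rewrite !(hornerD, hornerM, hornerZ, hornerX, hornerC, hornerXn) !mul0r mulr0 addr0 subr0.
have -> : b * (t * d.[t]) + t ^+ 2 * q.[t] = (f t - a) * d.[t] by rewrite mulrBl fE; ring.
rewrite normrM; have : `|d.[0]| / 2 < `|d.[t]|.
  have := ler_dist_dist d.[t] d.[0]; rewrite ler_norml => /andP[+ _].
  by move: dt; rewrite distrC; lra.
by have := normr_ge0 (f t - a); nra.
Qed.

Lemma jet_near_neq0 f a b : jet f a b -> a != 0 -> near0 (fun t => f t != 0).
Proof.
rewrite -normr_gt0 => fj /(jet_near fj); apply: near0_sub => t.
by apply: contraTneq => ->; rewrite sub0r normrN ltxx.
Qed.

Lemma jet_eq0_itv f a b (c1 c2 : R) : jet f a b -> c1 < c2 ->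
  (forall t, c1 < t -> t < c2 -> f t = 0) -> a = 0 /\ b = 0.
Proof.
move=> [e [q [e0 fE]]] c12 f0.
have line_e : (a%:P + b *: 'X) * e + 'X^2 * q = 0.
  apply: (poly_eq0_itv c12) => t t1 t2.
  by have := fE t; rewrite f0 // mul0r !hornerE => <-.
have a0 : a = 0.
  have /eqP := congr1 (horner_eval 0) line_e; rewrite /horner_eval.
  rewrite !(hornerD, hornerM, hornerZ, hornerX, hornerC, hornerXn).
  by rewrite mulr0 !mul0r !addr0 mulf_eq0 (negPf e0) orbF => /eqP.
have X_dvd : 'X * (b *: e + 'X * q) = 0.
  by rewrite -[RHS]line_e a0 polyC0 add0r mulrDr -scalerAr -scalerAl mulrA -expr2.
split=> //; move/eqP: X_dvd; rewrite mulf_eq0 polyX_eq0 /= => /eqP.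
move=> /(congr1 (horner_eval 0))/eqP.
by rewrite /horner_eval !hornerE mulf_eq0 (negPf e0) orbF => /eqP.
Qed.

Lemma jet_unique f a b c d : jet f a b -> jet f c d -> a = c /\ b = d.
Proof.
move=> fj /(jetM (jet_cst (-1)))/(jetD fj) fj0.
have [] := jet_eq0_itv fj0 (@ltr01 R); first by move=> t _ _; rewrite mulN1r subrr.
by rewrite mul0r add0r !mulN1r => /subr0_eq -> /subr0_eq.
Qed.

End Jets.

Section JetsOfPolynomials.
Variables (R : rcfType) (n : nat).
Implicit Types (p q : {mpoly R[n]}).

Section ChainRule.
Variables (F : 'I_n -> R -> R) (u w : 'I_n -> R).
Hypothesis F_jet : forall i, jet (F i) (u i) (w i).

Let chain_rule p :=
  jet (fun t => p.@[F^~ t]) p.@[u] (\sum_(i < n) (mderiv i p).@[u] * w i).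

Let chain_ruleC c : chain_rule c%:MP.
Proof.
rewrite /chain_rule mevalC big1 => [|i _]; last by rewrite mderivC meval0 mul0r.
by apply: eq_jet (jet_cst c) => t; rewrite mevalC.
Qed.

Let chain_ruleX i : chain_rule 'X_i.
Proof.
rewrite /chain_rule mevalXU (bigD1 i) //= big1 => [|j ji]; last first.
  by rewrite mderivX mnm1E eq_sym (negPf ji) scale0r meval0 mul0r.
rewrite mderivX mnm1E eqxx scale1r -[X in (X - _)%MM]add0m addmK mpolyX0 meval1 mul1r addr0.
by apply: eq_jet (F_jet i) => t; rewrite mevalXU.
Qed.

Let chain_ruleD p q : chain_rule p -> chain_rule q -> chain_rule (p + q).
Proof.
move=> pj qj; rewrite /chain_rule mevalD.
under eq_bigr do rewrite mderivD mevalD mulrDl.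
by rewrite big_split; apply: eq_jet (jetD pj qj) => t; rewrite mevalD.
Qed.

Let chain_ruleM p q : chain_rule p -> chain_rule q -> chain_rule (p * q).
Proof.
move=> pj qj; rewrite /chain_rule mevalM.
have -> : \sum_(i < n) (mderiv i (p * q)).@[u] * w i =
    (\sum_(i < n) (mderiv i p).@[u] * w i) * q.@[u] +
    p.@[u] * (\sum_(i < n) (mderiv i q).@[u] * w i).
  rewrite mulr_suml mulr_sumr -big_split; apply: eq_bigr => i _ /=.
  by rewrite mderivM mevalD !mevalM; ring.
by apply: eq_jet (jetM pj qj) => t; rewrite mevalM.
Qed.

Lemma jet_meval p : jet (fun t => p.@[F^~ t]) p.@[u] (\sum_(i < n) (mderiv i p).@[u] * w i).
Proof.
rewrite -/(chain_rule p); elim/mpolyind: p => [|c m p _ _ IH].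
  by rewrite -mpolyC0; apply: chain_ruleC.
apply: chain_ruleD => //; rewrite -mul_mpolyC; apply: chain_ruleM; first exact: chain_ruleC.
rewrite mpolyXE_id; elim/big_ind: _ => [||i _]; [|exact: chain_ruleM|].
  by rewrite -mpolyC1; apply: chain_ruleC.
elim: (m i) => [|k IHk]; first by rewrite expr0 -mpolyC1; apply: chain_ruleC.
by rewrite exprS; apply: chain_ruleM (chain_ruleX i) IHk.
Qed.

End ChainRule.
End JetsOfPolynomials.

Section Gradients.
Variables (R : realType) (n : nat).
Implicit Types (p : {mpoly R[n]}) (u w y : 'cV[R]_n).

Definition grad_dot p u w : R := \sum_(i < n) (mderiv i p).@[coordsv u] * w i ord0.

Lemma jet_mpoly_ray p u w :
  jet (fun t => p.@[coordsv (u + t *: w)]) p.@[coordsv u] (grad_dot p u w).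
Proof.
apply: eq_jet (jet_meval (fun i => jet_line (u i ord0) (w i ord0)) p) => t.
by apply: meval_eq => i; rewrite /coordsv !mxE mulrC.
Qed.

Definition coordsv_ev u : {rmorphism {mpoly R[n]} -> R} := meval (coordsv u).

Lemma polyfun_coordsv_cst c : polyfun coordsv_ev (fun=> c).
Proof. by exists c%:MP => u; rewrite /= mevalC. Qed.

Lemma polymx_coordsv_cst m k (M : 'M[R]_(m, k)) : polymx coordsv_ev (fun=> M).
Proof. exact/polymx_cst/polyfun_coordsv_cst. Qed.

Lemma polymx_coordsv_id : polymx coordsv_ev id.
Proof. by exists (\col_i 'X_i) => u; apply/colP=> i; rewrite !mxE /= mevalXU. Qed.

Definition affine y (H : 'M[R]_n) u : 'cV[R]_n := y + H *m u.

Lemma mpoly_comp_affine p y (H : 'M[R]_n) :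
  exists q : {mpoly R[n]}, forall u, q.@[coordsv u] = p.@[coordsv (affine y H u)].
Proof.
have [Q QE] : polymx coordsv_ev (affine y H).
  by apply: polymxD; [|apply: polymxM polymx_coordsv_id]; apply: polymx_coordsv_cst.
exists (p \mPo [tuple Q i ord0 | i < n]) => u.
by rewrite comp_mpoly_meval; apply: meval_eq => i; rewrite tnth_mktuple /coordsv QE !mxE.
Qed.

End Gradients.

Section AffinePullback.
Variables (R : realType) (n : nat).
Implicit Types (Z : 'cV[R]_n -> Prop) (H : 'M[R]_n) (y u w : 'cV[R]_n).

Lemma affine_line y H u w t : affine y H (u + t *: w) = affine y H u + t *: (H *m w).
Proof. by rewrite /affine mulmxDr -scalemxAr addrA. Qed.

Lemma affineK y H : H \in unitmx ->
  cancel (affine y H) (affine (- (invmx H *m y)) (invmx H)).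
Proof. by move=> Hu u; rewrite /affine mulmxDr mulKmx // addKr. Qed.

Lemma affine_pullbackK y H Z : H \in unitmx ->
  (Z \o affine y H) \o affine (- (invmx H *m y)) (invmx H) = Z.
Proof.
move=> Hu; apply/funext => u /=; congr Z.
by rewrite /affine mulmxDr mulmxN !mulKVmx // addrA subrr add0r.
Qed.

Lemma topbd_affine_pullback y H Z u : topbd (Z \o affine y H) u -> topbd Z (affine y H u).
Proof.
move=> bd e e0; pose K := l1norm (H^T *m H) + 1.
have K1 : 1 <= K by rewrite lerDr l1norm_ge0.
have K0 : 0 < K by apply: lt_le_trans K1.
have close v : sqnorm (v - u) < (e / K) ^+ 2 ->
    sqnorm (affine y H v - affine y H u) < e ^+ 2.
  rewrite opprD addrACA subrr add0r -mulmxBr !sqnormE => vu.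
  apply: le_lt_trans (ler_dot_mulmx _ _) _.
  apply: le_lt_trans (_ : K * dot (v - u) (v - u) < _).
    by rewrite ler_wpM2r ?dot_ge0 // lerDl.
  apply: lt_le_trans (_ : K * (e / K) ^+ 2 <= _); first by rewrite ltr_pM2l.
  have -> : K * (e / K) ^+ 2 = e ^+ 2 / K by field; rewrite gt_eqF.
  by rewrite ler_pdivrMr // ler_peMr ?sqr_ge0.
have [[v [Zv vu]] [w [Zw wu]]] := bd _ (divr_gt0 e0 K0).
by split; [exists (affine y H v)|exists (affine y H w)]; split=> //; apply: close.
Qed.

Let algbd_pull y H Z u : algbd (Z \o affine y H) u -> algbd Z (affine y H u).
Proof.
move=> bd p pv; have [q qE] := mpoly_comp_affine p y H; rewrite -qE.
by apply: bd => v /topbd_affine_pullback/pv; rewrite -qE.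
Qed.

Lemma algbd_affine_pullback y H Z u : H \in unitmx ->
  algbd (Z \o affine y H) u <-> algbd Z (affine y H u).
Proof.
move=> Hu; split=> [|bd]; first exact: algbd_pull.
by rewrite -[u](affineK y Hu); apply: algbd_pull; rewrite affine_pullbackK.
Qed.

Lemma grad_dot_comp_affine p q y H u w :
  (forall v, q.@[coordsv v] = p.@[coordsv (affine y H v)]) ->
  grad_dot q u w = grad_dot p (affine y H u) (H *m w).
Proof.
move=> qE; set y' := affine y H u; have p_jet : jet (fun t => q.@[coordsv (u + t *: w)])
    p.@[coordsv y'] (grad_dot p y' (H *m w)).
  by apply: eq_jet (jet_mpoly_ray p y' (H *m w)) => t; rewrite qE affine_line.
by have [] := jet_unique (jet_mpoly_ray q u w) p_jet.
Qed.

Let tangent_pull y H Z u w : tangent_space (algbd (Z \o affine y H)) u w ->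
  tangent_space (algbd Z) (affine y H u) (H *m w).
Proof.
move=> tan p pv; have [q qE] := mpoly_comp_affine p y H.
rewrite -/(grad_dot p _ _) -(grad_dot_comp_affine u w qE).
by apply: tan => v /algbd_pull/pv; rewrite -qE.
Qed.

Lemma tangent_algbd_affine_pullback y H Z u w : H \in unitmx ->
  tangent_space (algbd (Z \o affine y H)) u w <->
  tangent_space (algbd Z) (affine y H u) (H *m w).
Proof.
move=> Hu; split=> [|tan]; first exact: tangent_pull.
rewrite -[u](affineK y Hu) -[w](mulKmx Hu); apply: tangent_pull.
by rewrite affine_pullbackK.
Qed.

End AffinePullback.

(** * The kernel parametrization *)

Section KernelParametrization.
Variables (R : realType) (n : nat) (A : 'I_n -> 'M[R]_n).
Hypothesis As : forall j, (A j)^T = A j.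
Implicit Types (lam mu c d v : 'cV[R]_n) (p : {mpoly R[n]}).

Let polymx_lcomb_at_ray d v : polymx (@horner_ev R) (fun t => lcomb_at A (d + t *: v)).
Proof. by apply: polymx_lcomb_at (polymx_ray d v) => j; apply: polymx_horner_cst. Qed.

(* [lcomb_at (d + t v) (lam + t mu) = d + t v + t^2 lcomb_at v mu] as soon as
   [lcomb_at d mu = pencil lam v]. *)
Lemma jet_lam_killing d v j : lcomb_at A d \in unitmx ->
  jet (fun t => lam_killing A (d + t *: v) j ord0) (lam_killing A d j ord0)
      ((invmx (lcomb_at A d) *m (pencil A (lam_killing A d) *m v)) j ord0).
Proof.
move=> Bu; set lam := lam_killing A d; set mu := invmx _ *m _.
have Bmu : lcomb_at A d *m mu = pencil A lam *m v by rewrite mulKVmx.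
pose B t := lcomb_at A (d + t *: v).
have B_poly : polymx (@horner_ev R) B := polymx_lcomb_at_ray d v.
have expansion t : B t *m (lam + t *: mu) - t ^+ 2 *: (lcomb_at A v *m mu) = d + t *: v.
  rewrite /B lcomb_atD lcomb_atZ mulmxDl !mulmxDr lam_killingE //.
  rewrite -!scalemxAl -!scalemxAr Bmu pencil_mul.
  move: (lcomb_at A v *m mu) (lcomb_at A v *m lam) => Y X.
  by apply/colP=> k; rewrite !mxE; ring.
apply: (jet_quotient (h := fun t => \det (B t))
    (k := fun t => (- (\adj (B t) *m (lcomb_at A v *m mu))) j ord0)).
- exact: polyfun_det.
- by apply/polymx_entry/polymxN/polymxM; [apply: polymx_adj|apply: polymx_horner_cst].
- by rewrite /B scale0r addr0 -unitfE -unitmxE.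
move=> t; rewrite -unitfE -unitmxE => Btu.
have : \adj (B t) *m (d + t *: v) = \det (B t) *: lam_killing A (d + t *: v).
  by rewrite -[X in _ *m X = _](lam_killingE Btu) mulmxA mul_adj_mx mul_scalar_mx.
rewrite -expansion mulmxBr mulmxA mul_adj_mx mul_scalar_mx -scalemxAr => /colP/(_ j).
by move: (\adj _ *m _) => Y; rewrite !mxE => E; rewrite mulrC -E; ring.
Qed.

Lemma polymx_pencil_ray lam mu : polymx (@horner_ev R) (fun t => pencil A (lam + t *: mu)).
Proof. by apply: polymx_pencil (polymx_ray lam mu) => j; apply: polymx_horner_cst. Qed.

Lemma near0_lcomb_at_unit d v : lcomb_at A d \in unitmx ->
  near0 (fun t => lcomb_at A (d + t *: v) \in unitmx).
Proof.
move=> Bu; have [b det_jet] := jet_polyfun (polyfun_det (polymx_lcomb_at_ray d v)).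
have := jet_near_neq0 det_jet; rewrite scale0r addr0 -unitfE -unitmxE => /(_ Bu).
by apply: near0_sub => t; rewrite -unitfE -unitmxE.
Qed.

Section DeterminantAlongLine.
Variables (d lam mu : 'cV[R]_n).
Hypotheses (d0 : d != 0) (lam_d : pencil A lam *m d = 0).

Let N t := pencil A (lam + t *: mu) + d *m d^T.

(* Up to a multiple of [t], [N t] maps [d] to [dot d d *: d], so that the two
   terms of [\det (N t - d *m d^T)] cancel. *)
Let det_pencil_line t : N t \in unitmx ->
  \det (pencil A (lam + t *: mu)) * dot d d = - t * dot d (\adj (N t) *m (lcomb A mu *m d)).
Proof.
move=> Nu; have -> : pencil A (lam + t *: mu) = N t - d *m d^T by rewrite addrK.
have Nd : N t *m d = dot d d *: d - t *: (lcomb A mu *m d).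
  by rewrite mulmxDl pencil_line mulmxBl lam_d sub0r -scalemxAl mul_outer addrC.
have := congr1 (fun w => dot d (\adj (N t) *m w)) Nd.
rewrite det_sub_outer // mulmxA mul_adj_mx mul_scalar_mx mulmxBr -!scalemxAr.
by rewrite dotDr dotNr !dotZr => E; rewrite mulrBl E; ring.
Qed.

Lemma jet_det_pencil : pencil A lam + d *m d^T \in unitmx ->
  jet (fun t => \det (pencil A (lam + t *: mu))) 0
    (- (\det (pencil A lam + d *m d^T) * dot d (lcomb A mu *m d)) / dot d d ^+ 2).
Proof.
move=> N0u; have dd0 : dot d d != 0 by rewrite dot_eq0.
have N0E : N 0 = pencil A lam + d *m d^T by rewrite /N scale0r addr0.
have N_poly : polymx (@horner_ev R) N.
  by apply: polymxD; [apply: polymx_pencil_ray|apply: polymx_horner_cst].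
pose k t := - (dot d d)^-1 * dot d (\adj (N t) *m (lcomb A mu *m d)).
have k_poly : polyfun (@horner_ev R) k.
  apply: polyfunM; first exact: polyfun_horner_cst.
  apply: polyfun_dot; first exact: polymx_horner_cst.
  by apply: polymxM; [apply: polymx_adj|apply: polymx_horner_cst].
have k0 : k 0 = - (\det (N 0) * dot d (lcomb A mu *m d)) / dot d d ^+ 2.
  have adj_d : \adj (N 0) *m d = (\det (N 0) / dot d d) *: d.
    have : \adj (N 0) *m (N 0 *m d) = \det (N 0) *: d.
      by rewrite mulmxA mul_adj_mx mul_scalar_mx.
    rewrite {2}N0E mulmxDl lam_d add0r mul_outer -scalemxAr => E.
    by rewrite mulrC -scalerA -E scalerA mulVf ?scale1r.
  have N0_sym : (N 0)^T = N 0 by rewrite N0E linearD /= pencil_tr // outer_tr.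
  by rewrite /k [dot d (\adj _ *m _)]dot_trmx trmx_adj N0_sym adj_d dotZl; field.
have [g g_poly kE] := polyfun_factor k_poly.
rewrite -N0E -k0; apply: (jet_quotient (h := fun t => \det (N t))
  (k := fun t => g t * \det (N t))).
- exact: polyfun_det.
- by apply: polyfunM => //; apply: polyfun_det.
- by rewrite N0E -unitfE -unitmxE.
move=> t; rewrite -unitfE -unitmxE => /det_pencil_line det_t.
have -> : (0 + k 0 * t) * \det (N t) + t ^+ 2 * (g t * \det (N t)) = t * k t * \det (N t).
  by rewrite [k t]kE; ring.
by congr (_ * _); apply: (mulIf dd0); rewrite det_t /k; field.
Qed.

End DeterminantAlongLine.

Section BoundaryNearRegularPoint.
Variable c : 'cV[R]_n.
Hypotheses (c_reg : regular_kernel A c) (c_psd : psd (pencil A (lam_killing A c))).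

Lemma near0_psd_lam_killing v : near0 (fun t =>
  lcomb_at A (c + t *: v) \in unitmx /\ psd (pencil A (lam_killing A (c + t *: v)))).
Proof.
have [c0 Bu ker] := c_reg; have sym lam := pencil_tr lam As.
pose N := pencil A (lam_killing A c) + c *m c^T.
have N_posdef : posdef N by apply: posdef_add_outer.
have N_sym : N^T = N by rewrite linearD /= sym outer_tr.
have [e e0 open] := posdef_open N_sym N_posdef.
have [r r0 cont] := pencil_continuous A e0.
have dot_near : near0 (fun t => dot c (c + t *: v) != 0).
  have dot_jet := jet_line (dot c c) (dot c v).
  have := jet_near_neq0 dot_jet; rewrite dot_eq0 => /(_ c0).
  by apply: near0_sub => t; rewrite dotDr dotZr mulrC.
have lam_near : near0 (fun t => forall j,
    `|lam_killing A (c + t *: v) j ord0 - lam_killing A c j ord0| < r).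
  by apply: near0_forall => j; apply: jet_near (jet_lam_killing v j Bu) r0.
have := near0_and (near0_lcomb_at_unit v Bu) (near0_and dot_near lam_near).
apply: near0_sub => t [Btu [cd close]]; split=> //.
apply: (psd_of_posdef_add_outer (sym _) (pencil_lam_killing Btu) cd).
by apply: open; rewrite opprD addrACA subrr addr0; apply: cont => j; apply/ltW/close.
Qed.

Lemma vanishes_lam_killing p d : vanishes_on p (topbd (Sed A)) ->
  lcomb_at A d \in unitmx -> p.@[coordsv (lam_killing A d)] = 0.
Proof.
move=> pv Bu; have [r r0 near] := near0_psd_lam_killing (d - c).
have p_jet := jet_meval (fun j => jet_lam_killing (c - d) j Bu) p.
have [] // := jet_eq0_itv (c1 := 1 - r) (c2 := 1) p_jet; first by rewrite gtrBl.
move=> t t1 t2; have [|Btu psd_t] := near (1 - t); first by rewrite ger0_norm; lra.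
have -> : d + t *: (c - d) = c + (1 - t) *: (d - c) by apply/colP=> k; rewrite !mxE; ring.
apply: (pv (lam_killing A _)); apply: psd_singular_topbd_Sed => //.
apply/unitmx_kerP => /(_ _ (pencil_lam_killing Btu)) ct0.
have [c0 _ _] := c_reg; case/eqP: c0; move/unitmx_kerP: Btu; apply.
by rewrite ct0 -[X in lcomb_at _ X](scale0r c) lcomb_atZ scale0r mul0mx.
Qed.

Lemma algbd_Sed_lam_killing d : lcomb_at A d \in unitmx -> algbd (Sed A) (lam_killing A d).
Proof. by move=> Bu p pv; apply: vanishes_lam_killing. Qed.

(* [mu] is the velocity at 0 of [lam_killing (d + t v)] for a suitable [v]. *)
Lemma grad_dot_lam_killing p d mu : vanishes_on p (topbd (Sed A)) ->
  regular_kernel A d -> dot d (lcomb_at A d *m mu) = 0 ->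
  grad_dot p (lam_killing A d) mu = 0.
Proof.
move=> pv [d0 Bu ker] d_mu; set M := pencil A (lam_killing A d) in ker.
have Md : M *m d = 0 by apply: pencil_lam_killing.
have Ms : M^T = M by apply: pencil_tr.
have Nu := unitmx_add_outer Ms Md d0 ker.
pose v := invmx (M + d *m d^T) *m (lcomb_at A d *m mu).
have Nv : (M + d *m d^T) *m v = lcomb_at A d *m mu by rewrite mulKVmx.
have dv : dot d v = 0.
  have /esym/eqP := dot_add_outer v Ms Md; rewrite Nv d_mu.
  by rewrite mulf_eq0 dot_eq0 (negPf d0) orbF => /eqP.
have muE : invmx (lcomb_at A d) *m (M *m v) = mu.
  by move: Nv; rewrite mulmxDl mul_outer dv scale0r addr0 => ->; rewrite mulKmx.
have p_jet := jet_meval (fun j => jet_lam_killing v j Bu) p; rewrite -/M muE in p_jet.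
have [r r0 near] := near0_lcomb_at_unit v Bu.
have [] // := jet_eq0_itv p_jet r0.
by move=> t t0 tr; apply/(vanishes_lam_killing pv)/near; rewrite gtr0_norm.
Qed.

Lemma tangent_algbd_Sed d mu : regular_kernel A d ->
  tangent_space (algbd (Sed A)) (lam_killing A d) mu <-> dot d (lcomb_at A d *m mu) = 0.
Proof.
move=> d_reg; have [d0 Bu ker] := d_reg; split=> [tan|d_mu p pv]; last first.
  by apply: grad_dot_lam_killing => // l l_bd; apply: pv => q; apply.
have [D DE] : polyfun (@coordsv_ev R n) (fun lam => \det (pencil A lam)).
  apply: polyfun_det; apply: polymx_pencil (polymx_coordsv_id _ _) => j.
  exact: polymx_coordsv_cst.
have D0 : vanishes_on D (algbd (Sed A)).
  move=> l; apply=> l' /(topbd_Sed As)[_].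
  by rewrite unitmxE unitfE negbK DE => /eqP.
have det_pencil_unit : pencil A (lam_killing A d) + d *m d^T \in unitmx.
  by apply: unitmx_add_outer; rewrite ?pencil_tr ?pencil_lam_killing.
have det_jet := jet_det_pencil mu d0 (pencil_lam_killing Bu) det_pencil_unit.
have D_jet := jet_mpoly_ray D (lam_killing A d) mu.
rewrite [grad_dot _ _ _](tan D D0) in D_jet.
have [_ /eqP] := jet_unique det_jet (eq_jet (fun t => esym (DE _)) D_jet).
rewrite mulf_eq0 invr_eq0 expf_eq0 dot_eq0 (negPf d0) orbF oppr_eq0 mulf_eq0.
rewrite unitmxE unitfE in det_pencil_unit.
by rewrite (negPf det_pencil_unit) lcomb_mul => /eqP.
Qed.

End BoundaryNearRegularPoint.

End KernelParametrization.

(** * Tangency at the point defined by two zeros *)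

Section Quadrics.
Variables (R : comNzRingType) (n : nat) (A : 'I_n -> 'M[R]_n) (a : 'I_n -> 'cV[R]_n).
Implicit Types x d mu : 'cV[R]_n.

Definition half_jac x : 'M[R]_n := lcomb_at A x + \matrix_(i, j) a j i ord0.

Lemma half_jacE x : half_jac x = \matrix_(i, j) (A j *m x + a j) i ord0.
Proof. by apply/matrixP=> i j; rewrite !mxE. Qed.

Lemma half_jacD x d : half_jac (x + d) = half_jac x + lcomb_at A d.
Proof. by rewrite /half_jac lcomb_atD addrAC. Qed.

Lemma dot_mul_columns (F : 'I_n -> 'cV[R]_n) d mu :
  dot d ((\matrix_(i, j) F j i ord0) *m mu) = \sum_j mu j ord0 * dot d (F j).
Proof.
have -> : (\matrix_(i, j) F j i ord0) *m mu = \sum_j mu j ord0 *: F j.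
  by apply/colP=> i; rewrite mxE summxE; apply: eq_bigr => j _; rewrite !mxE mulrC.
by rewrite dot_sumr; apply: eq_bigr => j _; rewrite dotZr.
Qed.

End Quadrics.

Section QuadricsThroughTwoPoints.
Variables (R : realType) (n : nat).
Variables (A : 'I_n -> 'M[R]_n) (a : 'I_n -> 'cV[R]_n) (al : 'I_n -> R).
Hypothesis As : forall j, (A j)^T = A j.
Implicit Types (x d w mu : 'cV[R]_n).

Lemma meval_fpoly j x :
  (fpoly A a al j).@[coordsv x] = dot x (A j *m x) + 2 * dot (a j) x + al j.
Proof.
rewrite /fpoly !mevalD mevalC; congr (_ + _ + _).
  rewrite raddf_sum dotE; apply: eq_bigr => k _; rewrite raddf_sum mxE mulr_sumr.
  by apply: eq_bigr => l _; rewrite /= !mevalM mevalC !mevalXU /coordsv; ring.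
rewrite raddf_sum dotE mulr_sumr; apply: eq_bigr => k _.
by rewrite /= mevalM mevalC mevalXU /coordsv; ring.
Qed.

Lemma meval_fpoly_line j x w t : (fpoly A a al j).@[coordsv (x + t *: w)] =
  (fpoly A a al j).@[coordsv x] + 2 * dot w (A j *m x + a j) * t
    + t ^+ 2 * dot w (A j *m w).
Proof.
rewrite !meval_fpoly mulmxDr -scalemxAr !(dotDl, dotDr, dotZl, dotZr).
by rewrite [dot x (A j *m w)]dot_sym // ![dot (a j) _]dotC; ring.
Qed.

Lemma grad_dot_delta (p : {mpoly R[n]}) x i :
  grad_dot p x (delta_mx i ord0) = (mderiv i p).@[coordsv x].
Proof.
rewrite /grad_dot (bigD1 i) //= big1 => [|k /negPf ki]; last by rewrite mxE ki mulr0.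
by rewrite mxE !eqxx mulr1 addr0.
Qed.

Lemma Jacf_half_jac x : Jacf A a al x = 2 *: half_jac A a x.
Proof.
apply/matrixP=> i j; rewrite half_jacE mxE -grad_dot_delta [RHS]mxE [in RHS]mxE -dot_delta.
set w := delta_mx i ord0.
have f_jet : jet (fun t => (fpoly A a al j).@[coordsv (x + t *: w)])
    (fpoly A a al j).@[coordsv x] (2 * dot w (A j *m x + a j)).
  exists 1, (dot w (A j *m w))%:P; rewrite !hornerC oner_neq0; split=> // t.
  by rewrite !hornerC !mulr1 meval_fpoly_line.
by have [] := jet_unique (jet_mpoly_ray (fpoly A a al j) x w) f_jet.
Qed.

Lemma Sx_affine_pullback x : half_jac A a x \in unitmx ->
  Sx A a al x = Sed A \o affine (invmx (half_jac A a x) *m x) (- invmx (half_jac A a x)).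
Proof.
set J := half_jac A a x => Ju.
have gE u : affine (invmx J *m x) (- invmx J) u = invmx J *m (x - u).
  by rewrite /affine mulNmx mulmxBr.
apply/funext=> u; apply/propext; rewrite /= gE /Sx Jacf_half_jac -/J; split.
  case=> lam Slam ->; rewrite -scalemxAl scalerA mulVf ?pnatr_eq0 // scale1r.
  by rewrite opprB addrC subrK mulKmx.
exists (invmx J *m (x - u)) => //.
by rewrite -scalemxAl scalerA mulVf ?pnatr_eq0 // scale1r mulKVmx // opprB addrC subrK.
Qed.

(* This is [f_j (x + d) = f_j x], divided by two. *)
Definition secant_condition x d :=
  forall j, dot d (A j *m x + a j) = - 2^-1 * dot d (A j *m d).

Lemma Vf_secant_condition x x' : Vf A a al x -> Vf A a al x' -> secant_condition x (x' - x).
Proof.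
move=> Vx Vx' j; have := meval_fpoly_line j x (x' - x) 1.
by rewrite scale1r addrC subrK Vx Vx' expr1n !mul1r !mulr1; lra.
Qed.

Lemma dot_half_jac x d mu : secant_condition x d ->
  dot d (half_jac A a x *m mu) = - 2^-1 * dot d (lcomb_at A d *m mu).
Proof.
move=> secant; rewrite half_jacE !dot_mul_columns mulr_sumr.
by apply: eq_bigr => j _; rewrite secant mulrCA.
Qed.

Definition tangency_point x d := x - half_jac A a x *m lam_killing A d.

Lemma tangency_point_opp x d : lcomb_at A d \in unitmx ->
  tangency_point (x + d) (- d) = tangency_point x d.
Proof.
move=> Bu; rewrite /tangency_point -[X in lam_killing _ X]scaleN1r.
rewrite lam_killingZ ?oppr_eq0 ?oner_neq0 //.
by rewrite half_jacD mulmxDl lam_killingE // opprD addrA addrAC addrK.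
Qed.

Lemma bisector_tangency_point x x' : secant_condition x (x' - x) ->
  lcomb_at A (x' - x) \in unitmx -> bisector x x' (tangency_point x (x' - x)).
Proof.
set d := x' - x => secant Bu; have := dot_half_jac (lam_killing A d) secant.
rewrite lam_killingE // /bisector /tangency_point.
have -> : x' = x + d by rewrite addrC subrK.
clearbody d; move: (_ *m lam_killing A d) => y d_y.
have -> : x - y - x = - y by rewrite addrAC subrr add0r.
have -> : x - y - (x + d) = - (y + d) by rewrite opprD addrACA subrr add0r -opprD.
by rewrite !sqnormE !(dotNl, dotNr, dotDl, dotDr) [dot y d]dotC d_y; field.
Qed.

End QuadricsThroughTwoPoints.

Section Tangency.
Variables (R : realType) (n : nat).
Implicit Types (x d u : 'cV[R]_n).

Definition has_normal (Z : 'cV[R]_n -> Prop) u d :=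
  forall w, tangent_space Z u w <-> dot d w = 0.

Lemma has_normalN Z u d : has_normal Z u (- d) -> has_normal Z u d.
Proof.
move=> normal w; apply: iff_trans (normal w) _; rewrite dotNl.
by split=> [/eqP|->]; rewrite ?oppr0 // oppr_eq0 => /eqP.
Qed.

Lemma bisector_has_normal x x' u : bisector x x' u -> has_normal (bisector x x') u (x' - x).
Proof.
move=> bu w; pose c := dot x x - dot x' x'.
have sqnormB v : sqnorm (v - x) - sqnorm (v - x') = 2 * dot (x' - x) v + c.
  by rewrite !sqnormE !(dotDl, dotDr, dotNl, dotNr) [dot v x]dotC [dot v x']dotC /c; ring.
have line t : 2 * dot (x' - x) (u + t *: w) + c = 2 * dot (x' - x) w * t.
  by have := sqnormB u; rewrite bu subrr dotDr dotZr; lra.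
split=> [tan|dw p pv].
  have [p pE] : polyfun (@coordsv_ev R n) (fun v => 2 * dot (x' - x) v + c).
    apply: polyfunD; last exact: polyfun_coordsv_cst.
    apply: polyfunM; first exact: polyfun_nat.
    by apply: polyfun_dot (polymx_coordsv_id _ _); apply: polymx_coordsv_cst.
  have pv : vanishes_on p (bisector x x').
    by move=> v bv; rewrite -[LHS]pE -sqnormB bv subrr.
  have p_jet := jet_mpoly_ray p u w; rewrite [grad_dot _ _ _](tan p pv) in p_jet.
  have p_line : jet (fun t => p.@[coordsv (u + t *: w)]) 0 (2 * dot (x' - x) w).
    by apply: eq_jet (jet_line 0 _) => t; rewrite add0r -line pE.
  have [_] := jet_unique p_jet p_line.
  by move/esym/eqP; rewrite mulf_eq0 pnatr_eq0 /= => /eqP.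
have [] // := jet_eq0_itv (jet_mpoly_ray p u w) ltr01.
by move=> t _ _; apply: pv; apply/eqP; rewrite -subr_eq0 sqnormB line dw mulr0 mul0r.
Qed.

End Tangency.

Section TangencyOfSpectrahedra.
Variables (R : realType) (n : nat).
Variables (A : 'I_n -> 'M[R]_n) (a : 'I_n -> 'cV[R]_n) (al : 'I_n -> R).
Hypothesis As : forall j, (A j)^T = A j.
Variable c : 'cV[R]_n.
Hypotheses (c_reg : regular_kernel A c) (c_psd : psd (pencil A (lam_killing A c))).
Implicit Types x : 'cV[R]_n.

Section AtCommonZero.
Variables x d : 'cV[R]_n.
Hypotheses (Ju : half_jac A a x \in unitmx) (d_reg : regular_kernel A d).

Let J := half_jac A a x.
Let pull := affine (invmx J *m x) (- invmx J).

Let pull_unit : - invmx J \in unitmx.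
Proof. by rewrite -scaleN1r unitmxZ ?unitrN1 // unitmx_inv. Qed.

Let pull_tangency_point : pull (tangency_point A a x d) = lam_killing A d.
Proof.
by rewrite /pull /affine mulNmx -mulmxBr /tangency_point opprB addrC subrK mulKmx.
Qed.

Lemma algbd_Sx_tangency_point : algbd (Sx A a al x) (tangency_point A a x d).
Proof.
have [_ Bu _] := d_reg; rewrite Sx_affine_pullback //.
apply/algbd_affine_pullback; rewrite ?pull_unit // -/pull pull_tangency_point.
exact: algbd_Sed_lam_killing c_psd _ Bu.
Qed.

Lemma algbd_Sx_has_normal : secant_condition A a x d ->
  has_normal (algbd (Sx A a al x)) (tangency_point A a x d) d.
Proof.
move=> secant w; rewrite Sx_affine_pullback //.
apply: iff_trans (tangent_algbd_affine_pullback _ _ _ _ pull_unit) _.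
rewrite -/pull pull_tangency_point.
apply: iff_trans (tangent_algbd_Sed As c_reg c_psd _ d_reg) _.
have := dot_half_jac (- invmx J *m w) secant.
rewrite -/J mulNmx !mulmxN mulKVmx // !dotNr => dw.
by split=> [B0|w0]; move: dw; rewrite ?B0 ?w0; lra.
Qed.

End AtCommonZero.

Lemma meet_tangentially_of_regular x x' : Vf A a al x -> Vf A a al x' ->
  half_jac A a x \in unitmx -> half_jac A a x' \in unitmx -> regular_kernel A (x' - x) ->
  meet_tangentially (bisector x x') (algbd (Sx A a al x)) (algbd (Sx A a al x'))
    (tangency_point A a x (x' - x)).
Proof.
move=> Vx Vx' Ju Ju' d_reg; have [d0 Bu _] := d_reg; set u := tangency_point _ _ _ _.
have secant := Vf_secant_condition As Vx Vx'.
have d_reg' : regular_kernel A (x - x').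
  by rewrite -[x - x']opprB -scaleN1r; apply: regular_kernelZ; rewrite ?oppr_eq0 ?oner_neq0.
have uE : u = tangency_point A a x' (x - x').
  rewrite -[x - x']opprB -[x' in tangency_point _ _ x'](subrK x) [_ + x]addrC.
  by rewrite tangency_point_opp.
have bu : bisector x x' u := bisector_tangency_point secant Bu.
have normal_bisector := bisector_has_normal bu.
have normal_x := algbd_Sx_has_normal Ju d_reg secant.
have normal_x' : has_normal (algbd (Sx A a al x')) u (x' - x).
  apply: has_normalN; rewrite opprB uE; apply: algbd_Sx_has_normal => //.
  exact: Vf_secant_condition.
split=> // [||w|w]; first exact: algbd_Sx_tangency_point.
- by rewrite uE; apply: algbd_Sx_tangency_point.
- exact: iff_trans (normal_bisector w) (iff_sym (normal_x w)).
- exact: iff_trans (normal_bisector w) (iff_sym (normal_x' w)).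
Qed.

End TangencyOfSpectrahedra.

(** * Generic data *)

Section SymmetricData.
Variables (R : realType) (n : nat).
Implicit Types v : coefT n -> R.

(* Only the upper triangular coefficients are read: the coefficients below the
   diagonal are dummies, so that all of [coefT n] are independent parameters. *)
Definition sym_part v (j : 'I_n) : 'M[R]_n :=
  \matrix_(k, m) v (inl (inl (if (k <= m)%N then (j, k, m) else (j, m, k)))).
Definition lin_part v (j : 'I_n) : 'cV[R]_n := \col_i v (inl (inr (j, i))).
Definition cst_part v (j : 'I_n) : R := v (inr j).

Lemma sym_part_tr v j : (sym_part v j)^T = sym_part v j.
Proof. by apply/matrixP=> k m; rewrite !mxE; case: ltngtP => // /val_inj ->. Qed.

Lemma sym_partE v j (M : 'M[R]_n) : M^T = M ->
  (forall k m : 'I_n, (k <= m)%N -> v (inl (inl (j, k, m))) = M k m) -> sym_part v j = M.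
Proof.
move=> Ms vM; apply/matrixP=> k m; rewrite mxE; case: leqP => km; first exact: vM.
by rewrite vM 1?ltnW // -[in RHS]Ms mxE.
Qed.

Lemma polymx_sym_part j : polymx (@meval_fin R (coefT n)) (sym_part^~ j).
Proof. by apply: polymx_matrix => k m; apply: polyfun_meval_coord. Qed.

Lemma generic_symmetric_data
    (Q : ('I_n -> 'M[R]_n) -> ('I_n -> 'cV[R]_n) -> ('I_n -> R) -> Prop) :
  generic (fun v => Q (sym_part v) (lin_part v) (cst_part v)) ->
  exists P : {mpoly R[#|{: coefT n}|]},
    (exists A0 a0 al0, (forall i, (A0 i)^T = A0 i) /\ P.@[coords A0 a0 al0] != 0) /\
    (forall A a al, (forall i, (A i)^T = A i) -> P.@[coords A a al] != 0 -> Q A a al).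
Proof.
move=> [P0 [/meval_fin_neq0[v0 P0v0] P0Q]].
pose fill (v : coefT n -> R) (c : coefT n) : R := match c with
  | inl (inl (j, k, m)) => if (k <= m)%N then v c else v0 c
  | _ => v c
  end.
have [P PE] : polyfun (@meval_fin R (coefT n)) (fun v => meval_fin (fill v) P0).
  apply: (@polyfun_comp _ _ (fun v => meval_fin v P0)); first by exists P0.
  case=> [[[[j k] m]|c]|c]; try exact: polyfun_meval_coord.
  by rewrite /=; case: (k <= m)%N; [apply: polyfun_meval_coord|apply: polyfun_meval_cst].
have P_coords A a al : P.@[coords A a al] = meval_fin (fill (coef_of A a al)) P0.
  by rewrite PE.
exists P; split=> [|A a al As]; rewrite ?P_coords.
  exists (sym_part v0), (lin_part v0), (cst_part v0); split; first exact: sym_part_tr.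
  rewrite P_coords; congr (meval_fin _ P0 != 0): P0v0.
  apply/funext=> -[[[[j k] m]|[j i]]|j] //=; last by rewrite mxE.
  by case: ifP => // km; rewrite mxE km.
have symE : sym_part (fill (coef_of A a al)) = A.
  by apply/funext=> j; apply: sym_partE => // k m km; rewrite /= km.
have linE : lin_part (fill (coef_of A a al)) = a.
  by apply/funext=> j; apply/colP=> i; rewrite mxE.
by move=> /P0Q; rewrite symE linE.
Qed.

End SymmetricData.

Section RegularKernelTest.
Variables (R : fieldType) (n : nat).
Implicit Types (A : 'I_n -> 'M[R]_n) (d : 'cV[R]_n).

(* This is [\det B *: pencil A (lam_killing A d) + d *m d^T] for
   [B = lcomb_at A d], written polynomially. *)
Definition kernel_test_mx A d : 'M[R]_n :=
  (\det (lcomb_at A d))%:M - lcomb A (\adj (lcomb_at A d) *m d) + d *m d^T.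

Lemma regular_kernel_test A d : d != 0 -> lcomb_at A d \in unitmx ->
  kernel_test_mx A d \in unitmx -> regular_kernel A d.
Proof.
move=> d0 Bu; set B := lcomb_at A d.
have B0 : \det B != 0 by rewrite -unitfE -unitmxE.
have -> : kernel_test_mx A d = \det B *: pencil A (lam_killing A d) + d *m d^T.
  rewrite /kernel_test_mx -/B -[X in \adj B *m X](lam_killingE Bu) mulmxA mul_adj_mx.
  by rewrite mul_scalar_mx lcombZ scalerBr scalemx1.
move=> test; split=> //; apply: (kernel_in_lineZ B0).
apply: kernel_in_line_rank1 test => //.
by rewrite -scalemxAl pencil_lam_killing // scaler0.
Qed.

Lemma polymx_kernel_test (S : comNzRingType) (V : Type) (ev : V -> {rmorphism S -> R})
    (A : V -> 'I_n -> 'M[R]_n) (d : V -> 'cV[R]_n) :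
  (forall j, polymx ev (A^~ j)) -> polymx ev d ->
  polymx ev (fun v => kernel_test_mx (A v) (d v)).
Proof.
move=> A_poly d_poly; have B_poly := polymx_lcomb_at A_poly d_poly.
apply: polymxD; last by apply: polymxM => //; apply: polymx_tr.
apply: polymxD; first exact/polymx_scalar/polyfun_det.
apply/polymxN/(polymx_lcomb A_poly)/polymxM => //; exact: polymx_adj.
Qed.

End RegularKernelTest.

Section SecantChart.
Variables (R : realType) (n : nat) (l : 'I_n).
Implicit Types (v : coefT n -> R) (x d : 'cV[R]_n).

Let base v : 'cV[R]_n := \col_j v (inr j).
Let axis v : 'cV[R]_n := \col_k if k == l then 1 else v (inl (inr (k, l))).
Let dir v : 'cV[R]_n := v (inl (inr (l, l))) *: axis v.
Let rest v (j : 'I_n) : 'cV[R]_n := \col_i if i == l then 0 else v (inl (inr (j, i))).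
Let lin v (j : 'I_n) : 'cV[R]_n := rest v j -
  dot (axis v) (sym_part v j *m (2^-1 *: dir v + base v) + rest v j) *: delta_mx l ord0.

(* A chart of the incidence variety of data, zero [x] and secant direction [d]
   with [d l 0 != 0]: as [axis v] has coordinate 1 at [l], the secant condition
   determines the coordinates [lin v j l 0], which makes room for [d]; the
   equations at [x] determine the constant terms, which makes room for [x]. *)
Let chart v (c : coefT n) : R :=
  match c with
  | inl (inl _) => v c
  | inl (inr (j, i)) => lin v j i ord0
  | inr j => - (dot (base v) (sym_part v j *m base v) + 2 * dot (lin v j) (base v))
  end.

Let test v := \det (half_jac (sym_part v) (lin v) (base v)) *
  \det (lcomb_at (sym_part v) (dir v)) * \det (kernel_test_mx (sym_part v) (dir v)).

Let base_poly : polymx (@meval_fin R (coefT n)) base.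
Proof. by apply: polymx_matrix => i j; apply: polyfun_meval_coord. Qed.

Let axis_poly : polymx (@meval_fin R (coefT n)) axis.
Proof.
apply: polymx_matrix => i j; case: (i == l); first exact: polyfun_meval_cst.
exact: polyfun_meval_coord.
Qed.

Let dir_poly : polymx (@meval_fin R (coefT n)) dir.
Proof. by apply: polymxZ axis_poly; apply: polyfun_meval_coord. Qed.

Let lin_poly j : polymx (@meval_fin R (coefT n)) (lin^~ j).
Proof.
have rest_poly : polymx (@meval_fin R (coefT n)) (rest^~ j).
  apply: polymx_matrix => i k; case: (i == l); first exact: polyfun_meval_cst.
  exact: polyfun_meval_coord.
apply: polymxD => //; apply: polymxN.
apply: polymxZ; last exact/polymx_cst/polyfun_meval_cst.
apply: polyfun_dot axis_poly _; apply: polymxD => //.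
apply: polymxM; first exact: polymx_sym_part.
by apply: polymxD base_poly; apply: polymxZ dir_poly; apply: polyfun_meval_cst.
Qed.

Let chart_poly c : polyfun (@meval_fin R (coefT n)) (chart^~ c).
Proof.
case: c => [[c|[j i]]|j]; [exact: polyfun_meval_coord|exact: polymx_entry (lin_poly j)|].
apply: polyfunN; apply: polyfunD.
  by apply: polyfun_dot base_poly _; apply: polymxM base_poly; apply: polymx_sym_part.
by apply: polyfunM; [apply: polyfun_meval_cst|apply: polyfun_dot (lin_poly j) base_poly].
Qed.

Let test_poly : polyfun (@meval_fin R (coefT n)) test.
Proof.
have A_poly := @polymx_sym_part R n.
apply: polyfunM; first apply: polyfunM; apply: polyfun_det.
- apply: polymxD; first exact: polymx_lcomb_at.
  by apply: polymx_matrix => i j; apply: polymx_entry.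
- exact: polymx_lcomb_at.
- exact: polymx_kernel_test.
Qed.

(* [A_j] exchanges the basis vectors [j] and [l], and [x = d] is the basis
   vector [l]. *)
Let witness (c : coefT n) : R :=
  match c with
  | inl (inl (j, k, m)) => ((k == j) && (m == l) || (k == l) && (m == j))%:R
  | inl (inr (k, i)) => ((k == l) && (i == l))%:R
  | inr j => (j == l)%:R
  end.

Let e : 'cV[R]_n := delta_mx l ord0.

Let axis_witness : axis witness = e.
Proof. by apply/colP=> k; rewrite !mxE /= !eqxx andbT; case: (k == l). Qed.

Let dir_witness : dir witness = e.
Proof. by rewrite /dir axis_witness /= !eqxx scale1r. Qed.

Let base_witness : base witness = e.
Proof. by apply/colP=> k; rewrite !mxE eqxx andbT. Qed.

Let sym_witness j : sym_part witness j = \matrix_(k, m) witness (inl (inl (j, k, m))).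
Proof.
apply: sym_partE => [|k m _]; last by rewrite mxE.
by apply/matrixP=> k m; rewrite !mxE /= orbC [X in (X || _)]andbC [X in (_ || X)]andbC.
Qed.

Let sym_witness_mul j : sym_part witness j *m e = delta_mx j ord0.
Proof.
rewrite sym_witness -colE; apply/colP=> k; rewrite !mxE /= !eqxx !andbT.
by have [->//|kj] := eqVneq k j; have [<-|//] := eqVneq k l; rewrite (negPf kj).
Qed.

Let lcomb_at_witness : lcomb_at (sym_part witness) e = 1%:M.
Proof. by apply/matrixP=> i j; rewrite mxE sym_witness_mul !mxE eqxx andbT. Qed.

Let kernel_test_witness : kernel_test_mx (sym_part witness) e = 1%:M.
Proof.
rewrite /kernel_test_mx lcomb_at_witness adj1 det1 mul1mx lcomb_delta.
rewrite trmx_delta mul_delta_mx.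
suff -> : sym_part witness l = delta_mx l l by rewrite subrK.
by rewrite sym_witness; apply/matrixP=> k m; rewrite !mxE /= orbb.
Qed.

Let lin_witness j : lin witness j = - (3 / 2 * (j == l)%:R) *: e.
Proof.
have rest0 : rest witness j = 0.
  by apply/colP=> i; rewrite !mxE /=; case: eqP; rewrite ?andbF.
rewrite /lin rest0 axis_witness dir_witness base_witness addr0 sub0r -scaleNr.
have -> : 2^-1 *: e + e = (3 / 2) *: e by apply/colP=> k; rewrite !mxE; field.
by rewrite -scalemxAr dotZr sym_witness_mul dot_delta mxE eqxx andbT eq_sym.
Qed.

Let test_witness : test witness != 0.
Proof.
have -> : test witness = \det (1%:M - (3 / 2) *: e *m e^T).
  rewrite /test dir_witness base_witness /half_jac lcomb_at_witness kernel_test_witness.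
  rewrite !det1 !mulr1; congr (\det (1%:M + _)).
  apply/matrixP=> i j; rewrite mxE lin_witness !mxE big_ord1 !mxE eqxx andbT.
  by rewrite andbT; ring.
rewrite det_rank1 dotZr dot_delta mxE !eqxx mulr1.
have -> : 1 - 3 / 2 = - 2^-1 :> R by field.
by rewrite oppr_eq0 invr_eq0 pnatr_eq0.
Qed.

Let chart_onto w x d : d l ord0 != 0 ->
  Vf (sym_part w) (lin_part w) (cst_part w) x ->
  secant_condition (sym_part w) (lin_part w) x d ->
  exists v, [/\ chart v =1 w, base v = x, dir v = d, sym_part v = sym_part w &
    lin v = lin_part w].
Proof.
move=> dl Vx secant; pose v (c : coefT n) : R := match c with
  | inl (inl _) => w c
  | inl (inr (j, i)) =>
      if i == l then (if j == l then d l ord0 else d j ord0 / d l ord0) else w c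
  | inr j => x j ord0
  end.
have baseE : base v = x by apply/colP=> j; rewrite mxE.
have dirE : dir v = d.
  apply/colP=> j; rewrite !mxE /= !eqxx.
  by case: (eqVneq j l) => [->|jl]; rewrite ?mulr1 // mulrC divfK.
have dE : d = d l ord0 *: axis v by rewrite -[LHS]dirE /dir /= !eqxx.
have axis_l : axis v l ord0 = 1 by rewrite mxE eqxx.
have symE : sym_part v = sym_part w.
  by apply/funext=> j; apply/matrixP=> i m; rewrite !mxE.
have linE : lin v = lin_part w.
  apply/funext=> j; pose a := lin_part w j.
  have restE : rest v j = a - a l ord0 *: delta_mx l ord0.
    apply/colP=> i; rewrite !mxE /= andbT; case: (eqVneq i l) => [->|il].
      by rewrite mulr1 subrr.
    by rewrite mulr0 subr0.
  have axis_secant : dot (axis v) (sym_part w j *m (2^-1 *: d + x) + a) = 0.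
    apply: (mulfI dl); rewrite mulr0 -dotZl -dE mulmxDr -scalemxAr -addrA dotDr dotZr.
    by rewrite secant; ring.
  rewrite /lin dirE baseE symE restE addrA dotDr axis_secant add0r dotNr dotZr dotC.
  by rewrite dot_delta axis_l mulr1 scaleNr opprK subrK.
exists v; split=> // -[[c|[j i]]|j] //=; first by rewrite linE mxE.
by rewrite linE baseE symE; have := Vx j; rewrite meval_fpoly /cst_part; lra.
Qed.

Lemma generic_secant_regular : generic (fun v : coefT n -> R =>
  forall x d, d l ord0 != 0 -> Vf (sym_part v) (lin_part v) (cst_part v) x ->
  secant_condition (sym_part v) (lin_part v) x d ->
  half_jac (sym_part v) (lin_part v) x \in unitmx /\ regular_kernel (sym_part v) d).
Proof.
have test_neq0 : exists v, test v != 0 by exists witness.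
apply: generic_sub (generic_image chart_poly test_poly test_neq0) => w chart_w x d dl Vx secant.
have [v [/chart_w + baseE dirE symE linE]] := chart_onto dl Vx secant.
rewrite /test symE linE baseE dirE !mulf_eq0 !negb_or.
rewrite -!unitfE -!unitmxE => /andP[/andP[Ju Bu] test_unit]; split=> //.
by apply: regular_kernel_test => //; apply: contraNneq dl => ->; rewrite mxE.
Qed.

End SecantChart.

Section EigenvectorTest.
Variables (T : comNzRingType) (n : nat) (o : 'I_n).
Implicit Types A : 'I_n -> 'M[T]_n.

Definition rank1_shift A (theta : T) : 'M[T]_n :=
  theta%:M - A o + const_mx 1 *m (const_mx 1 : 'cV[T]_n)^T.

(* If [A o *m e = theta *: e] and [rank1_shift A theta] is invertible, then its
   adjugate maps the vector of ones to a nonzero multiple of [e]: this turns the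
   invertibility of [lcomb_at A e] into a condition on [theta] alone. *)
Definition eigen_test A (theta : T) : T :=
  \det (rank1_shift A theta) * \det (lcomb_at A (\adj (rank1_shift A theta) *m const_mx 1)).

End EigenvectorTest.

Lemma rmorph_eigen_test (T T' : comNzRingType) (f : {rmorphism T -> T'})
    n (o : 'I_n) A theta :
  f (eigen_test o A theta) = eigen_test o (fun j => map_mx f (A j)) (f theta).
Proof.
have shiftE : map_mx f (rank1_shift o A theta) =
    rank1_shift o (fun j => map_mx f (A j)) (f theta).
  by rewrite map_mxD map_mxB map_scalar_mx map_mxM -map_trmx map_const_mx rmorph1.
rewrite /eigen_test rmorphM -!det_map_mx map_lcomb_at map_mxM map_mx_adj shiftE.
by rewrite map_const_mx rmorph1.
Qed.

Lemma rank1_shift_mul_eigen (T : comNzRingType) n (o : 'I_n) (A : 'I_n -> 'M[T]_n) theta e :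
  A o *m e = theta *: e -> rank1_shift o A theta *m e = dot (const_mx 1) e *: const_mx 1.
Proof. by move=> Ae; rewrite mulmxDl mulmxBl mul_scalar_mx Ae subrr add0r mul_outer. Qed.

Definition regular_eigenvector (F : fieldType) n (o : 'I_n) (A : 'I_n -> 'M[F]_n) theta e :=
  lcomb_at A e \in unitmx /\ kernel_in_line (theta%:M - A o) e.

Lemma eigen_test_regular (F : fieldType) n (o : 'I_n) (A : 'I_n -> 'M[F]_n) theta e :
  e != 0 -> A o *m e = theta *: e -> eigen_test o A theta != 0 ->
  regular_eigenvector o A theta e.
Proof.
move=> e0 Ae; rewrite mulf_eq0 negb_or => /andP[N0 B0].
have Nu : rank1_shift o A theta \in unitmx by rewrite unitmxE unitfE.
have Ne := rank1_shift_mul_eigen Ae; split; last first.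
  by apply: kernel_in_line_rank1 Nu => //; rewrite mulmxBl mul_scalar_mx Ae subrr.
have k0 : dot (const_mx 1) e != 0.
  apply: contraNneq e0 => k0; apply/eqP; move/unitmx_kerP: Nu; apply.
  by rewrite Ne k0 scale0r.
have eE : \det (rank1_shift o A theta) *: e =
    dot (const_mx 1) e *: (\adj (rank1_shift o A theta) *m const_mx 1).
  by rewrite scalemxAr -Ne mulmxA mul_adj_mx mul_scalar_mx.
by rewrite -(lcomb_at_unitZ A e N0) eE lcomb_at_unitZ // unitmxE unitfE.
Qed.

Lemma horner_mx_eigen (T : comNzRingType) n (M : 'M[T]_n.+1) theta (e : 'cV_n.+1) p :
  M *m e = theta *: e -> horner_mx M p *m e = p.[theta] *: e.
Proof.
move=> Me; elim/poly_ind: p => [|p k IH]; first by rewrite rmorph0 mul0mx horner0 scale0r.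
rewrite rmorphD rmorphM /= horner_mx_X horner_mx_C hornerMXaddC mulmxDl mul_scalar_mx.
by rewrite -mulmxE -mulmxA Me -scalemxAr IH scalerA mulrC -scalerDl.
Qed.

Section GenericEigenvectors.
Variables (R : realType) (n : nat) (o : 'I_n.+1).
Implicit Types (A : 'I_n.+1 -> 'M[R]_n.+1) (e : 'cV[R]_n.+1).

Let eigen_poly A : {poly R} := eigen_test o (fun j => map_mx polyC (A j)) 'X.

Let horner_eigen_poly A theta : (eigen_poly A).[theta] = eigen_test o A theta.
Proof.
rewrite -/(horner_eval theta _) rmorph_eigen_test /= /horner_eval hornerX; congr eigen_test.
by apply/funext=> j; apply/matrixP=> i k; rewrite !mxE /= hornerC.
Qed.

Let eigen_poly_neq0 A theta e : e != 0 -> A o *m e = theta *: e ->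
  \det (horner_mx (A o) (eigen_poly A)) != 0 -> eigen_test o A theta != 0.
Proof.
move=> e0 Ae; rewrite -unitfE -unitmxE => /unitmx_kerP ker0; apply: contraNneq e0 => test0.
by apply/eqP/ker0; rewrite (horner_mx_eigen _ Ae) horner_eigen_poly test0 scale0r.
Qed.

Let ones : 'cV[R]_n.+1 := const_mx 1.
Let basis (i : 'I_n.+1) : 'cV[R]_n.+1 := delta_mx i ord0.
Let spike (j : 'I_n.+1) : 'cV[R]_n.+1 := ones + basis j.
Let eigenval (i : 'I_n.+1) : R := i.+1%:R.

Let witness (j : 'I_n.+1) : 'M[R]_n.+1 :=
  if j == o then diag_mx (\row_i eigenval i) else spike j *m (spike j)^T.

Let witness_eigen i : witness o *m basis i = eigenval i *: basis i.
Proof.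
rewrite /witness eqxx; apply/colP=> k; rewrite mul_diag_mx !mxE eqxx andbT.
by case: eqP => [->|]; rewrite ?mulr0.
Qed.

Let dot_ones_basis i : dot ones (basis i) = 1.
Proof. by rewrite dotC dot_delta mxE. Qed.

Let rank1_shift_witness_unit i : rank1_shift o witness (eigenval i) \in unitmx.
Proof.
apply/unitmx_kerP=> v; rewrite mulmxDl mul_outer -/ones => Nv.
have coord k : (eigenval i - eigenval k) * v k ord0 + dot ones v = 0.
  have /colP/(_ k) := Nv; rewrite mulmxBl mul_scalar_mx /witness eqxx mul_diag_mx.
  by rewrite !mxE mulr1 -mulrBl.
have sum0 : dot ones v = 0 by have := coord i; rewrite subrr mul0r add0r.
have v_off k : k != i -> v k ord0 = 0.
  move=> ki; have /eqP := coord k; rewrite sum0 addr0 mulf_eq0 subr_eq0 eqr_nat eqSS.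
  by rewrite eq_sym (negPf (ki : val k != val i)) => /eqP.
apply/colP=> k; rewrite mxE; have [->|/v_off //] := eqVneq k i.
move: sum0; rewrite dotE (bigD1 i) //= big1 ?addr0 ?mxE ?mul1r // => m /v_off ->.
by rewrite mulr0.
Qed.

Let spike_coord_gt0 j i : 0 < spike j i ord0.
Proof. by rewrite !mxE ltr_wpDr ?ler0n. Qed.

Let witness_spike j i : j != o -> witness j *m basis i = spike j i ord0 *: spike j.
Proof. by move=> jo; rewrite /witness (negPf jo) mul_outer [dot _ _]dotC dot_delta. Qed.

(* With [s] the sum of the coordinates of [nu], the relation becomes
   [kappa basis_i + s ones + nu = 0]; its coordinate at [o] and the sum of its
   coordinates force [s = 0]. *)
Let spike_independent (kappa : R) (nu : 'cV[R]_n.+1) i : nu o ord0 = 0 ->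
  kappa *: basis i + \sum_j nu j ord0 *: spike j = 0 -> kappa = 0 /\ nu = 0.
Proof.
move=> nu_o rel; pose s := dot ones nu.
have rel_nu : kappa *: basis i + (s *: ones + nu) = 0.
  rewrite -[RHS]rel; congr (_ + _); under [RHS]eq_bigr do rewrite scalerDr.
  rewrite big_split -scaler_suml /=; congr (_ *: _ + _).
    by rewrite /s dotE; apply: eq_bigr => j _; rewrite mxE mul1r.
  by rewrite [LHS]matrix_sum_delta; apply: eq_bigr => j _; rewrite big_ord1.
have dot_ones : dot ones ones = n.+1%:R.
  by rewrite dotE (eq_bigr (fun=> 1)) ?sumr_const ?card_ord // => j _; rewrite !mxE mulr1.
have total : kappa + (s * n.+1%:R + s) = 0.
  have := congr1 (dot ones) rel_nu.
  by rewrite dot0r !dotDr !dotZr dot_ones_basis dot_ones mulr1.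
have at_o : kappa * (o == i)%:R + s = 0.
  by have /colP/(_ o) := rel_nu; rewrite !mxE nu_o eqxx andbT mulr1 addr0.
have s0 : s = 0.
  move: at_o total; case: eqP => _; rewrite ?mulr0 ?add0r // mulr1 => /eqP.
  rewrite addr_eq0 => /eqP ->; rewrite addrCA addNr addr0 => /eqP.
  by rewrite mulf_eq0 pnatr_eq0 orbF => /eqP.
have kappa0 : kappa = 0 by have := total; rewrite s0 mul0r !addr0.
by split=> //; move: rel_nu; rewrite kappa0 s0 !scale0r !add0r.
Qed.

Let lcomb_at_witness_unit i : lcomb_at witness (basis i) \in unitmx.
Proof.
apply/unitmx_kerP=> lam lam_ker.
pose nu : 'cV[R]_n.+1 := \col_j if j == o then 0 else lam j ord0 * spike j i ord0.
have rel : (lam o ord0 * eigenval i) *: basis i + \sum_j nu j ord0 *: spike j = 0.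
  rewrite -[RHS]lam_ker -lcomb_mul mulmx_suml (bigD1 o) //= [RHS](bigD1 o) //=.
  rewrite mxE eqxx scale0r add0r -scalemxAl witness_eigen scalerA; congr (_ + _).
  by apply: eq_bigr => j jo; rewrite -scalemxAl witness_spike // scalerA mxE (negPf jo).
have [|lam_o nu0] := spike_independent _ rel; first by rewrite mxE eqxx.
apply/colP=> j; rewrite mxE; have [->|jo] := eqVneq j o.
  by move/eqP: lam_o; rewrite mulf_eq0 pnatr_eq0 orbF => /eqP.
have /colP/(_ j) := nu0; rewrite mxE (negPf jo) [RHS]mxE => /eqP.
by rewrite mulf_eq0 (gt_eqF (spike_coord_gt0 j i)) orbF => /eqP.
Qed.

Let witness_eigen_test i : eigen_test o witness (eigenval i) != 0.
Proof.
have Nu := rank1_shift_witness_unit i.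
have Ne := rank1_shift_mul_eigen (witness_eigen i); rewrite dot_ones_basis scale1r in Ne.
rewrite /eigen_test -Ne mulmxA mul_adj_mx mul_scalar_mx mulf_neq0 //.
  by rewrite -unitfE -unitmxE.
by rewrite -unitfE -unitmxE lcomb_at_unitZ ?lcomb_at_witness_unit // -unitfE -unitmxE.
Qed.

Let test (v : coefT n.+1 -> R) :=
  \det (horner_mx (sym_part v o) (eigen_poly (sym_part v))).

Let test_poly : polyfun (@meval_fin R (coefT n.+1)) test.
Proof.
pose ev := @meval_fin R (coefT n.+1).
apply: polyfun_det; apply: polymx_horner_mx; first exact: polymx_sym_part.
have A_poly j : polymx (map_poly_ev ev) (fun v => map_mx polyC (sym_part v j)).
  exact/polymx_polyC/polymx_sym_part.
have ones_poly : polymx (map_poly_ev ev) (fun=> const_mx 1 : 'cV_n.+1).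
  by exists (const_mx 1) => v; rewrite map_const_mx rmorph1.
have N_poly : polymx (map_poly_ev ev)
    (fun v => rank1_shift o (fun j => map_mx polyC (sym_part v j)) 'X).
  apply: polymxD; last by apply: polymxM => //; apply: polymx_tr.
  by apply: polymxD; [apply/polymx_scalar/polyfun_polyX|apply: polymxN].
apply: polyfunM; apply: polyfun_det => //.
by apply: polymx_lcomb_at => //; apply: polymxM => //; apply: polymx_adj.
Qed.

Let test_witness : exists v, test v != 0.
Proof.
exists (coef_of witness (fun=> 0) (fun=> 0)); rewrite /test.
have -> : sym_part (coef_of witness (fun=> 0) (fun=> 0)) = witness.
  apply/funext=> j; apply: sym_partE => //; rewrite /witness; case: ifP => _.
    by rewrite tr_diag_mx.
  exact: outer_tr.
rewrite {1}/witness eqxx horner_mx_diag det_diag; apply/prodf_neq0 => i _.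
by rewrite !mxE horner_eigen_poly; apply: witness_eigen_test.
Qed.

Lemma generic_eigenvectors : generic (fun v : coefT n.+1 -> R =>
  forall theta e, e != 0 -> sym_part v o *m e = theta *: e ->
  regular_eigenvector o (sym_part v) theta e).
Proof.
apply: generic_sub (generic_neq0 test_poly test_witness) => v test_v theta e e0 Ae.
exact/(eigen_test_regular e0 Ae)/(eigen_poly_neq0 e0 Ae).
Qed.

End GenericEigenvectors.

Lemma exists_psd_regular_kernel (R : realType) n (A : 'I_n -> 'M[R]_n) (o : 'I_n) :
  (forall j, (A j)^T = A j) ->
  (forall theta e, e != 0 -> A o *m e = theta *: e -> regular_eigenvector o A theta e) ->
  exists2 c, regular_kernel A c & psd (pencil A (lam_killing A c)).
Proof.
move=> As eigen; have basis0 : delta_mx o ord0 != 0 :> 'cV[R]_n.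
  by rewrite -dot_eq0 dot_delta mxE !eqxx oner_neq0.
have Ao0 : A o != 0.
  apply: contraNneq (basis0) => Ao0; have [|Bu _] := eigen 0 _ basis0.
    by rewrite Ao0 mul0mx scale0r.
  apply/eqP; move/unitmx_kerP: Bu; apply.
  by rewrite -lcomb_mul lcomb_delta Ao0 mul0mx.
have [t psd_t /nonunitmx_ker[e e0]] := critical_pencil (As o) Ao0.
rewrite mulmxBl mul1mx -scalemxAl => /subr0_eq/esym tAe.
have t0 : t != 0 by apply: contraNneq e0 => t0; rewrite -tAe t0 scale0r.
have [|Bu ker] := eigen t^-1 e e0; first by rewrite -[in RHS]tAe scalerK.
have pencilE : pencil A (t *: delta_mx o ord0) = 1%:M - t *: A o.
  by rewrite /pencil lcombZ lcomb_delta.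
have lamE : lam_killing A e = t *: delta_mx o ord0.
  apply/esym/lam_killing_uniq => //.
  by rewrite pencilE mulmxBl mul1mx -scalemxAl tAe subrr.
exists e; last by rewrite lamE pencilE.
split=> //; rewrite lamE pencilE.
apply: (kernel_in_lineZ (invr_neq0 t0)).
by rewrite scalerBr scalerK // scalemx1.
Qed.

Definition regular_data (R : realType) n (A : 'I_n -> 'M[R]_n) a al :=
  (forall x x', Vf A a al x -> Vf A a al x' -> x != x' ->
    half_jac A a x \in unitmx /\ regular_kernel A (x' - x)) /\
  exists2 c, regular_kernel A c & psd (pencil A (lam_killing A c)).

Lemma generic_regular_data (R : realType) n : generic (fun v : coefT n.+1 -> R =>
  regular_data (sym_part v) (lin_part v) (cst_part v)).
Proof.
have := generic_and (generic_forall (@generic_secant_regular R n.+1))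
  (generic_eigenvectors R ord0).
apply: generic_sub => v [secant eigen]; have As := sym_part_tr v; split.
  move=> x x' Vx Vx'; rewrite eq_sym -subr_eq0 => /cV0Pn[l dl].
  exact: secant dl Vx (Vf_secant_condition As Vx Vx').
exact: exists_psd_regular_kernel eigen.
Qed.

Theorem theorem4p5 (R : realType) (n : nat) :
  exists P : {mpoly R[#|{: coefT n}|]},
    (exists (A0 : 'I_n -> 'M[R]_n) (a0 : 'I_n -> 'cV[R]_n) (al0 : 'I_n -> R),
        (forall i, (A0 i)^T = A0 i) /\ P.@[coords A0 a0 al0] != 0) /\
    (forall (A : 'I_n -> 'M[R]_n) (a : 'I_n -> 'cV[R]_n) (al : 'I_n -> R),
        (forall i, (A i)^T = A i) ->
        P.@[coords A a al] != 0 ->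
        forall x x' : 'cV[R]_n,
          Vf A a al x -> Vf A a al x' -> x != x' ->
          exists u : 'cV[R]_n,
            meet_tangentially (bisector x x')
              (algbd (Sx A a al x)) (algbd (Sx A a al x')) u).
Proof.
apply: generic_symmetric_data; case: n => [|n].
  exists 1; split=> [|v _ x x' _ _ /eqP[]]; first exact: oner_neq0.
  by apply/colP=> -[].
apply: generic_sub (generic_regular_data R n) => v [regular [c c_reg c_psd]].
move=> x x' Vx Vx' xx'; have [Ju d_reg] := regular x x' Vx Vx' xx'.
have [|Ju' _] := regular x' x Vx' Vx; first by rewrite eq_sym.
exists (tangency_point (sym_part v) (lin_part v) x (x' - x)).
exact: (meet_tangentially_of_regular (sym_part_tr v) c_reg c_psd Vx Vx' Ju Ju' d_reg).
Qed.
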